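(* Let $A$ be an associative (not necessarily commutative) superalgebra over $\mathbb{Q}$. For $n\ge 0$ let $\mu_n\in D_n(A)$ be $$\mu_n(a_0,\ldots,a_n)=\frac{1}{(n+1)!}\sum_{\sigma\in\Sigma_{n+1}}\epsilon(\sigma)\,a_{\sigma(0)}a_{\sigma(1)}\cdots a_{\sigma(n)},$$ where $\Sigma_{n+1}$ is the group of permutations of $\{0,\ldots,n\}$, and let $\rho_n=[\mu_n,-]\colon D(A)\to D(A)$. Then for all $n,m\ge 0$ $$[\mu_n,\mu_m]=(n-m)\frac{(n+m+1)!}{(n+1)!(m+1)!}\,\mu_{n+m},$$ and the map $\exp\big(-\sum_{n\ge1}K_n\rho_n\big)\colon D(A)\to D(A)$ is an isomorphism of Lie superalgebras. Define, for every linear $f\colon A\to A$, the elements $\Phi^i_f\in D_{i-1}(A)$, $i\ge 1$, by $$\sum_{i=1}^\infty\Phi^i_f=\exp\left(-\sum_{n=1}^\infty K_n\rho_n\right)f .$$ Then for all linear $f,g\colon A\to A$: 1. $\Phi^{n+1}_{\mathrm{Id}}=(-1)^n\mu_n$ for every $n\ge 0$; 2. $\Phi^n_{[f,g]}=\sum_{i=1}^n\big[\Phi^i_f,\Phi^{n-i+1}_g\big]$ for every $n\ge 1$; 3. $\Phi^1_f=f$ and $\Phi^{n+1}_f=\frac1n\sum_{h=1}^n(-1)^h\big[\mu_h,\Phi^{n-h+1}_f\big]$ for every $n\ge1$.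
   Context: $(K_n)_{n\ge 1}$ is the sequence of rational numbers (Koszul numbers) determined by $\exp\left(\sum_{n\ge1}K_n\frac{t^{n+1}}{(n+1)!}\frac{d}{dt}\right)(t)=e^t-1$ in $\mathbb{Q}[[t]]$. A superalgebra is a $\mathbb{Z}/2$-graded algebra $A=A^0\oplus A^1$, not necessarily unital; $|a|\in\{0,1\}$ is the parity of a homogeneous element $a$. Linear operators may be even, odd, or sums of both. $S(p,q)$ is the set of permutations $\sigma$ of $p+q$ ordered indices that are increasing on the first $p$ indices and on the last $q$ indices. The Koszul sign of a permutation $\sigma$ with respect to homogeneous elements $a_0,\dots,a_n$ is $\epsilon(\sigma)=(-1)^\alpha$, where $\alpha$ is the number of pairs $i<j$ with $\sigma(i)>\sigma(j)$ and $|a_{\sigma(i)}||a_{\sigma(j)}|=1$. $D_n(A)=\mathrm{Hom}^*(A^{\odot n+1},A)$ is the super vector space of all (even and odd) supersymmetric multilinear maps in $n+1$ variables; $D(A)=\prod_{n\ge0}D_n(A)$. For $f\in D_n(A)$, $g\in D_m(A)$ put $$(f\barwedge g)(v_0,\ldots,v_{n+m})=\sum_{\sigma\in S(m+1,n)}\epsilon(\sigma)\,f\big(g(v_{\sigma(0)},\ldots,v_{\sigma(m)}),v_{\sigma(m+1)},\ldots,v_{\sigma(m+n)}\big),$$ and $[f,g]=f\barwedge g-(-1)^{|f||g|}g\barwedge f\in D_{n+m}(A)$ (Nijenhuis–Richardson bracket), extended componentwise to $D(A)$, which becomes a Lie superalgebra; on $D_0(A)=\mathrm{Hom}^*(A,A)$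 it is the supercommutator. Since $\rho_n$ raises the index of $D_\bullet(A)$ by $n$, the exponential is well defined (each component is a finite sum), and $\Phi^i_f$ is the component of $\exp(-\sum K_n\rho_n)f$ in $D_{i-1}(A)$. *)

(* Defs.v *)
From HB Require Import structures.
From mathcomp Require Import all_boot all_order all_algebra all_fingroup.
From mathcomp Require Import boolp classical_sets functions.

Set Implicit Arguments.
Unset Strict Implicit.
Unset Printing Implicit Defensive.
Import GRing.Theory.
Local Open Scope ring_scope.
Local Open Scope classical_set_scope.

(** * Koszul numbers *)

(* A formal power series over rat is the sequence of its coefficients. *)
Definition fps := nat -> rat.

Definition fps_mul (p q : fps) : fps := fun k => \sum_(i < k.+1) p i * q (k - i)%N.

Definition fps_deriv (p : fps) : fps := fun k => k.+1%:R * p k.+1.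

(* The coefficients of \sum_(n >= 1) K_n t^(n+1) / (n+1)!; K 0 is not used. *)
Definition koszul_series (K : nat -> rat) : fps :=
  fun k => if (2 <= k)%N then K k.-1 / (k`!)%:R else 0.

Definition koszul_field (K : nat -> rat) (p : fps) : fps :=
  fps_mul (koszul_series K) (fps_deriv p).

(* [koszul_field K] raises the order of a series by at least one, so that only
   the powers j <= k contribute to the coefficient of t^k. *)
Definition exp_koszul_field (K : nat -> rat) (p : fps) : fps :=
  fun k => \sum_(j < k.+1) (j`!)%:R^-1 * iter j (koszul_field K) p k.

Definition fps_t : fps := fun k => (k == 1%N)%:R.

Definition fps_expm1 : fps := fun k => if k is 0 then 0 else (k`!)%:R^-1.

Definition koszul_numbers (K : nat -> rat) : Prop :=
  exp_koszul_field K fps_t =1 fps_expm1.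

(** * Superalgebras over the rationals *)

(* The grading A = A^0 (+) A^1 is given by the projections [hcomp false] and
   [hcomp true] onto the even and the odd part. *)
HB.mixin Record isSuperalgebra A of GRing.Lmodule rat A := {
  hcomp : bool -> A -> A;
  hcomp_is_linear : forall b, linear (hcomp b);
  hcompK : forall a b x, hcomp a (hcomp b x) = if a == b then hcomp b x else 0;
  hcompD : forall x, hcomp false x + hcomp true x = x;
  smul : A -> A -> A;
  smul_is_linearl : forall y, linear (smul^~ y);
  smul_is_linearr : forall x, linear (smul x);
  smulA : associative smul;
  smul_graded : forall a b x y,
    hcomp (a (+) b) (smul (hcomp a x) (hcomp b y)) =
    smul (hcomp a x) (hcomp b y)
}.

#[short(type="superAlgType")]
HB.structure Definition Superalgebra :=
  { A of isSuperalgebra A & GRing.Lmodule rat A }.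

Definition homog (A : superAlgType) (b : bool) (x : A) : Prop := hcomp b x = x.

(** * Permutations, shuffles and Koszul signs *)

(* [shuffle p s] says that s belongs to S(p, N - p). *)
Definition shuffle (p N : nat) (s : 'S_N) : bool :=
  [forall i : 'I_N, forall j : 'I_N,
     (i < j)%N && ((j < p) || (p <= i))%N ==> (s i < s j)%N].

(* Here [par i] is the parity of the i-th element. *)
Definition koszul_sign (N : nat) (s : 'S_N) (par : 'I_N -> bool) : rat :=
  (-1) ^+ #|[set ij : 'I_N * 'I_N |
             [&& (ij.1 < ij.2)%N, (s ij.2 < s ij.1)%N,
                 par (s ij.1) & par (s ij.2)]]%SET|.

(** * Cochains *)

(* Arbitrary maps A^(n+1) -> A; D_n(A) is the subset [Dn A n] below. *)
Definition cochain (A : superAlgType) (n : nat) : Type :=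
  {ffun 'I_n.+1 -> A} -> A.

HB.instance Definition _ (A : superAlgType) (n : nat) :=
  GRing.Lmodule.copy (cochain A n) ({ffun 'I_n.+1 -> A} -> A).

Section Cochains.
Variable A : superAlgType.

Definition homog_args N (par : {ffun 'I_N -> bool}) (v : {ffun 'I_N -> A}) : Prop :=
  forall i, homog (par i) (v i).

Definition par_sum N (par : {ffun 'I_N -> bool}) : bool :=
  \big[addb/false]_(i < N) par i.

Definition args_comp N (par : {ffun 'I_N -> bool}) (v : {ffun 'I_N -> A}) :
  {ffun 'I_N -> A} := [ffun i => hcomp (par i) (v i)].

Definition update N (v : {ffun 'I_N -> A}) (i : 'I_N) (x : A) :
  {ffun 'I_N -> A} := [ffun j => if j == i then x else v j].

Definition multilinear n (f : cochain A n) : Prop :=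
  forall (i : 'I_n.+1) (v : {ffun 'I_n.+1 -> A}),
    linear (fun x : A => f (update v i x)).

Definition supersymmetric n (f : cochain A n) : Prop :=
  forall (s : 'S_n.+1) (par : {ffun 'I_n.+1 -> bool}) (v : {ffun 'I_n.+1 -> A}),
    homog_args par v -> f [ffun i => v (s i)] = koszul_sign s par *: f v.

Definition Dn n : set (cochain A n) :=
  [set f | multilinear f /\ supersymmetric f].

Definition cochain_parity n (b : bool) (f : cochain A n) : Prop :=
  forall (par : {ffun 'I_n.+1 -> bool}) (v : {ffun 'I_n.+1 -> A}),
    homog_args par v -> homog (b (+) par_sum par) (f v).

(* The component of parity b of a multilinear map. *)
Definition cochain_part n (b : bool) (f : cochain A n) : cochain A n :=
  fun v => \sum_(par : {ffun 'I_n.+1 -> bool})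
    hcomp (b (+) par_sum par) (f (args_comp par v)).

Definition cast_cochain n m (e : n = m) (f : cochain A n) : cochain A m :=
  fun v => f [ffun i => v (cast_ord (congr1 S e) i)].

(* The defining formula makes sense for homogeneous arguments; it is extended
   multilinearly by summing over all parities of the arguments.  The entries
   m.+1, ..., m + n of a shuffle are reached as m + i with 0 < i <= n. *)
Definition barwedge n m (f : cochain A n) (g : cochain A m) : cochain A (n + m) :=
  fun v => \sum_(par : {ffun 'I_(n + m).+1 -> bool})
    \sum_(s : 'S_(n + m).+1 | shuffle m.+1 s)
      let w := [ffun k : 'I_(n + m).+1 => args_comp par v (s k)] in
      koszul_sign s par *:
        f [ffun i : 'I_n.+1 =>
             if i == ord0 then g [ffun j : 'I_m.+1 => w (inord j)]
             else w (inord (m + i))].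

(* The sign in the bracket requires homogeneous maps: the formula is extended
   bilinearly through the decomposition into even and odd parts. *)
Definition nr_bracket n m (f : cochain A n) (g : cochain A m) : cochain A (n + m) :=
  \sum_(a : bool) \sum_(b : bool)
    (barwedge (cochain_part a f) (cochain_part b g)
     - (-1) ^+ (a && b) *:
         cast_cochain (addnC m n) (barwedge (cochain_part b g) (cochain_part a f))).

(* Product of a nonempty sequence of elements (A need not be unital). *)
Definition sprod n (v : {ffun 'I_n.+1 -> A}) : A :=
  foldl smul (v ord0) [seq v (lift ord0 i) | i <- enum 'I_n].

Definition mu n : cochain A n :=
  fun v => ((n.+1)`!)%:R^-1 *:
    \sum_(par : {ffun 'I_n.+1 -> bool}) \sum_(s : 'S_n.+1)
      koszul_sign s par *: sprod [ffun i => args_comp par v (s i)].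

End Cochains.

Arguments Dn A n : clear implicits.
Arguments mu A n : clear implicits.

(** * The product of the D_n(A) *)

(* D(A) is the subset [DD A] of the space of all sequences of cochains. *)
Definition cochains (A : superAlgType) : Type := forall n : nat, cochain A n.

HB.instance Definition _ (A : superAlgType) := gen_eqMixin (cochains A).
HB.instance Definition _ (A : superAlgType) := gen_choiceMixin (cochains A).

Section CochainsLmodule.
Variable A : superAlgType.
Implicit Types F G H : cochains A.

Let zero : cochains A := fun n => 0.
Let opp F : cochains A := fun n => - F n.
Let add F G : cochains A := fun n => F n + G n.
Let scale (a : rat) F : cochains A := fun n => a *: F n.

Let addA : associative add.
Proof. by move=> F G H; apply: functional_extensionality_dep => n; exact: addrA. Qed.
Let addC : commutative add.
Proof. by move=> F G; apply: functional_extensionality_dep => n; exact: addrC. Qed.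
Let add0 : left_id zero add.
Proof. by move=> F; apply: functional_extensionality_dep => n; exact: add0r. Qed.
Let addN : left_inverse zero opp add.
Proof. by move=> F; apply: functional_extensionality_dep => n; exact: addNr. Qed.

HB.instance Definition _ :=
  GRing.isZmodule.Build (cochains A) addA addC add0 addN.

Let scaleA a b F : scale a (scale b F) = scale (a * b) F.
Proof. by apply: functional_extensionality_dep => n; exact: scalerA. Qed.
Let scale1 : left_id 1 scale.
Proof. by move=> F; apply: functional_extensionality_dep => n; exact: scale1r. Qed.
Let scaleDr : right_distributive scale +%R.
Proof. by move=> a F G; apply: functional_extensionality_dep => n; exact: scalerDr. Qed.
Let scaleDl F : {morph scale^~ F : a b / a + b}.
Proof. by move=> a b; apply: functional_extensionality_dep => n; exact: scalerDl. Qed.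

HB.instance Definition _ :=
  GRing.Zmodule_isLmodule.Build rat (cochains A) scaleA scale1 scaleDr scaleDl.

End CochainsLmodule.

(* Otherwise the arguments of the sequences below would become implicit. *)
Unset Implicit Arguments.

Definition DD (A : superAlgType) : set (cochains A) :=
  [set F | forall n, Dn A n (F n)].

Definition cochains_parity {A : superAlgType} (b : bool) (F : cochains A) : Prop :=
  forall n, cochain_parity b (F n).

(* The embedding of the factor of index n into the product. *)
Definition in_degree {A : superAlgType} {n : nat} (f : cochain A n) : cochains A :=
  fun k => if @eqP _ n k is ReflectT e then cast_cochain e f else 0.

(* The projection onto the factor of index n, seen inside the product. *)
Definition component {A : superAlgType} (n : nat) (F : cochains A) : cochains A :=
  in_degree (F n).

(* [F, G]_k is the sum of the [F_i, G_j] over i + j = k. *)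
Definition bracket {A : superAlgType} (F G : cochains A) : cochains A :=
  fun k => \sum_(i < k.+1)
    cast_cochain (subnKC (leq_ord i)) (nr_bracket (F i) (G (k - i)%N)).

Definition rho {A : superAlgType} (n : nat) (F : cochains A) : cochains A :=
  bracket (in_degree (mu A n)) F.

(* The operator - \sum_(n >= 1) K_n rho_n: since rho_n raises the index by n,
   only the terms n <= k contribute to the component of index k. *)
Definition koszul_op {A : superAlgType} (K : nat -> rat) (F : cochains A) : cochains A :=
  fun k => - \sum_(1 <= n < k.+1) K n *: rho n F k.

(* The exponential of [koszul_op K], which raises the index by at least 1, so
   that only the powers j <= k contribute to the component of index k. *)
Definition exp_koszul_op {A : superAlgType} (K : nat -> rat) (F : cochains A) : cochains A :=
  fun k => \sum_(j < k.+1) (j`!)%:R^-1 *: iter j (koszul_op K) F k.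

Definition lie_superalgebra_iso {A : superAlgType} (E : cochains A -> cochains A) : Prop :=
  [/\ set_bij (DD A) (DD A) E,
      forall (a : rat) F G, DD A F -> DD A G -> E (a *: F + G) = a *: E F + E G,
      forall b F, DD A F -> cochains_parity b F -> cochains_parity b (E F)
    & forall F G, DD A F -> DD A G -> E (bracket F G) = bracket (E F) (E G)].

(* A map A -> A seen as a cochain of index 0. *)
Definition cochain0 {A : superAlgType} (f : A -> A) : cochain A 0 := fun v => f (v ord0).

(* For i >= 1, the component Phi^i_f in D_(i-1)(A), seen inside D(A). *)
Definition Phi {A : superAlgType} (K : nat -> rat) (i : nat) (f : cochain A 0) : cochains A :=
  component i.-1 (exp_koszul_op K (in_degree f)).

(* Main.v *)
Require Import Defs.
From HB Require Import structures.
From mathcomp Require Import all_boot all_order all_algebra all_fingroup.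
From mathcomp Require Import boolp classical_sets functions.
From mathcomp Require Import zify ring.

Set Implicit Arguments.
Unset Strict Implicit.
Unset Printing Implicit Defensive.
Import GRing.Theory.
Local Open Scope ring_scope.

(** Cochains are evaluated on lists of homogeneous elements, where a sum over
    shuffles becomes the sum over the splittings of a list into two sublists,
    i.e. the (graded cocommutative, coassociative) unshuffle coproduct; both
    properties follow by induction on the list.  They give the pre-Lie identity
    for the insertion product, hence the Jacobi identity.  Convolution with
    respect to this coproduct is an associative product on list functions, of
    which [(n+1)! mu_n] is the [(n+1)]-st power of the identity; since inserting
    an even cochain is a derivation of the convolution, inserting [mu_m] in
    [(n+1)! mu_n] gives [(n+1)/(m+1)!] times the [(n+m+1)]-st power, whence the
    formula for [[mu_n, mu_m]].

    Thus [- \sum K_n rho_n] is a derivation raising the index, and its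
    exponential is an automorphism, with inverse the exponential for [-K].  By
    the bracket formula, [mu_n |-> - t^(n+1)/(n+1)! d/dt] is a morphism to vector
    fields, which turns [- \sum K_n rho_n] into [ad X] with
    [X = \sum K_n t^(n+1)/(n+1)! d/dt].  From
    [X (p x') = (ad_X p) x' + p (X x)'] one gets
    [exp X (p x') = (exp (ad X) p) (exp X x)'], and [p = x = t] gives
    [exp (ad X) t = (e^t - 1)/e^t = 1 - e^(-t)], that is, the value
    [\sum (-1)^n mu_n] of the exponential at the identity.  Applying the
    exponential to [[Id, f] = 0] then yields the recurrence, as [[Id, -]] is
    [-n] on [D_n(A)]. *)

(** * Functions on lists of homogeneous elements *)

Section ListFunctions.
Variable A : superAlgType.

Lemma hcomp_linear b : linear (@hcomp A b).
Proof. exact: hcomp_is_linear. Qed.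
HB.instance Definition _ b :=
  GRing.isLinear.Build rat A A *:%R (@hcomp A b) (@hcomp_linear b).

Lemma smul_linearr (x : A) : linear (smul x).
Proof. exact: smul_is_linearr. Qed.
HB.instance Definition _ (x : A) :=
  GRing.isLinear.Build rat A A *:%R (@smul A x) (@smul_linearr x).

Lemma smulDl (x y z : A) : smul (x + y) z = smul x z + smul y z.
Proof. by have := smul_is_linearl z 1 x y; rewrite !scale1r. Qed.
Lemma smul0l (z : A) : smul 0 z = 0.
Proof. by apply: (addrI (smul 0 z)); rewrite -smulDl !addr0. Qed.
Lemma smulZl c (x z : A) : smul (c *: x) z = c *: smul x z.
Proof. by have := smul_is_linearl z c x 0; rewrite smul0l !addr0. Qed.

(* The parity is part of the data because 0 is homogeneous of both parities. *)
Definition tagged_elt := {x : bool * A | hcomp x.1 x.2 == x.2}.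
Local Notation T := tagged_elt.

Lemma mktag_subproof b (x : A) : hcomp (b, hcomp b x).1 (b, hcomp b x).2 == (b, hcomp b x).2.
Proof. by rewrite /= hcompK eqxx. Qed.
Definition mktag b (x : A) : T := exist _ (b, hcomp b x) (mktag_subproof b x).
Definition tpar (t : T) : bool := (val t).1.
Definition tval (t : T) : A := (val t).2.

Lemma tval_hcomp t : hcomp (tpar t) (tval t) = tval t.
Proof. exact: (eqP (valP t)). Qed.
Lemma mktagE t : mktag (tpar t) (tval t) = t.
Proof. by apply: val_inj; rewrite /= tval_hcomp -surjective_pairing. Qed.
Lemma mktag_neq b t : b != tpar t -> mktag b (tval t) = mktag b 0.
Proof.
by move=> h; apply: val_inj; rewrite /= -tval_hcomp hcompK (negbTE h) linear0.
Qed.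

Fixpoint seq_par (l : seq T) : bool := if l is a :: l' then tpar a (+) seq_par l' else false.

Lemma seq_par_cat l1 l2 : seq_par (l1 ++ l2) = seq_par l1 (+) seq_par l2.
Proof. by elim: l1 => //= a l ->; rewrite addbA. Qed.

(* The sum of [K x y] over the splittings of [l] into sublists [x] and [y], with
   the Koszul sign of the permutation that takes [l] to [x ++ y]. *)
Fixpoint unshuf (l : seq T) (K : seq T -> seq T -> A) : A :=
  if l is a :: l' then
    unshuf l' (fun x y => K (a :: x) y)
    + unshuf l' (fun x y => (-1) ^+ (tpar a && seq_par x) *: K x (a :: y))
  else K [::] [::].

(** Every splitting preserves total length and total parity, so kernels need only agree under these
    two constraints; terms are discarded by length and signs compared by parity in this way. *)
Lemma eq_unshuf l K K' :
  (forall x y, (size x + size y = size l)%N -> seq_par x (+) seq_par y = seq_par l ->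
    K x y = K' x y) ->
  unshuf l K = unshuf l K'.
Proof.
elim: l K K' => [|a l IH] K K' h /=; first exact: h.
congr (_ + _); apply: IH => x y sxy pxy.
  by apply: h => /=; [rewrite addSn sxy | rewrite -addbA pxy].
by congr (_ *: _); apply: h => /=; [rewrite addnS sxy | rewrite addbCA pxy].
Qed.

Lemma unshuf_linear (g : {linear A -> A}) l K :
  g (unshuf l K) = unshuf l (fun x y => g (K x y)).
Proof.
elim: l K => //= a l IH K; rewrite linearD !IH; congr (_ + _).
by apply: eq_unshuf => x y _ _; rewrite linearZ.
Qed.

Lemma unshufD l K K' : unshuf l (fun x y => K x y + K' x y) = unshuf l K + unshuf l K'.
Proof.
elim: l K K' => //= a l IH K K'; rewrite IH addrACA; congr (_ + _).
by rewrite -IH; apply: eq_unshuf => x y _ _; rewrite scalerDr.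
Qed.

Lemma unshufZ l c K : unshuf l (fun x y => c *: K x y) = c *: unshuf l K.
Proof. by rewrite (unshuf_linear ( *:%R c)). Qed.

Lemma unshuf0 l : unshuf l (fun _ _ => 0) = 0.
Proof. by rewrite (eq_unshuf (K' := fun _ _ => 0 *: 0)) ?unshufZ => *; rewrite scale0r. Qed.

Lemma unshuf_sum (I : Type) (r : seq I) (P : pred I) l (K : I -> seq T -> seq T -> A) :
  unshuf l (fun x y => \sum_(i <- r | P i) K i x y) = \sum_(i <- r | P i) unshuf l (K i).
Proof.
elim: r => [|i r IH].
  by rewrite big_nil -[RHS](unshuf0 l); apply: eq_unshuf => *; rewrite big_nil.
rewrite big_cons -IH; case hP: (P i); last first.
  by apply: eq_unshuf => x y _ _; rewrite big_cons hP.
by rewrite -unshufD; apply: eq_unshuf => x y _ _; rewrite big_cons hP.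
Qed.

(** Left counit law: the only splitting with empty first part carries no sign. *)
Lemma unshuf_nill l K : unshuf l (fun x y => if x is [::] then K y else 0) = K l.
Proof.
elim: l K => //= a l IH K; rewrite unshuf0 add0r -[RHS](IH (fun y => K (a :: y))).
by apply: eq_unshuf => -[|b x] y _ _ /=; rewrite ?andbF ?scale1r // scaler0.
Qed.

Lemma unshuf_nilr l K : unshuf l (fun x y => if y is [::] then K x else 0) = K l.
Proof.
elim: l K => //= a l IH K; rewrite (IH (fun x => K (a :: x))).
by rewrite (eq_unshuf (K' := fun _ _ => 0)) ?unshuf0 ?addr0 // => *; rewrite scaler0.
Qed.

(** Coassociativity: both sides sum over the splittings into three sublists, and the induction
    follows the head of the list into each of the three. *)
Lemma unshuf_coassoc l K :
  unshuf l (fun x y => unshuf y (K x)) = unshuf l (fun x y => unshuf x (fun p q => K p q y)).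
Proof.
elim: l K => //= a l IH K; rewrite (IH (fun x => K (a :: x))) unshufD -addrA.
congr (_ + _).
under eq_unshuf => x y _ _ do rewrite scalerDr -2!unshufZ.
rewrite unshufD.
rewrite (IH (fun x p q => (-1) ^+ (tpar a && seq_par x) *: K x (a :: p) q)); congr (_ + _).
rewrite (IH (fun x p q => (-1) ^+ (tpar a && seq_par x) *: ((-1) ^+ (tpar a && seq_par p) *: K
  x p (a :: q)))).
apply: eq_unshuf => x y _ _; rewrite -unshufZ.
(* The sign for passing [x] is the product of those for passing [p] and [q], since the parity of [x]
   is the sum of theirs. *)
apply: eq_unshuf => p q _ <-; rewrite scalerA -signr_addb.
by congr (_ ^+ _ *: _); case: (tpar a); case: (seq_par p); case: (seq_par q).
Qed.

(** Graded cocommutativity: exchanging the two parts exchanges the two branches of the recursion. *)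
Lemma unshuf_cocomm l K :
  unshuf l K = unshuf l (fun x y => (-1) ^+ (seq_par x && seq_par y) *: K y x).
Proof.
elim: l K => [|a l IH] K /=; first by rewrite scale1r.
rewrite addrC; congr (_ + _); rewrite IH; apply: eq_unshuf => x y _ _;
  rewrite !scalerA -!signr_addb; congr (_ ^+ _ *: _);
  by case: (tpar a); case: (seq_par x); case: (seq_par y).
Qed.

(** Coassociativity groups the first two of three sublists into one part, on which cocommutativity
    then acts. *)
Lemma unshuf_comm12 l K :
  unshuf l (fun x y => unshuf y (K x)) =
  unshuf l (fun x y => unshuf y (fun p q => (-1) ^+ (seq_par x && seq_par p) *: K p x q)).
Proof.
rewrite unshuf_coassoc (unshuf_coassoc l (fun x p q =>
  (-1) ^+ (seq_par x && seq_par p) *: K p x q)).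
by apply: eq_unshuf => x y _ _; rewrite unshuf_cocomm.
Qed.

(** * Multilinear and supersymmetric functions on lists *)

Implicit Types L F G H : seq T -> A.

Definition lmultilin L := forall l1 b l2, linear (fun x => L (l1 ++ mktag b x :: l2)).
(** Adjacent transpositions generate the symmetric group; the sign of an arbitrary permutation is
    recovered in [lsupersym_perm]. *)
Definition lsupersym L := forall l1 a c l2,
  L (l1 ++ a :: c :: l2) = (-1) ^+ (tpar a && tpar c) *: L (l1 ++ c :: a :: l2).

Lemma lmultilin_head L b l : lmultilin L -> linear (fun x => L (mktag b x :: l)).
Proof. by move=> hL; exact: (hL [::] b l). Qed.

Lemma lmultilin0 L l1 b l2 : lmultilin L -> L (l1 ++ mktag b 0 :: l2) = 0.
Proof.
move=> hL; have := hL l1 b l2 (-1) 0 0; rewrite scaler0 addr0 scaleN1r => h.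
by rewrite {1}h addNr.
Qed.

Lemma lmultilinZ L l1 b l2 c x : lmultilin L ->
  L (l1 ++ mktag b (c *: x) :: l2) = c *: L (l1 ++ mktag b x :: l2).
Proof. by move=> hL; have := hL l1 b l2 c x 0; rewrite lmultilin0 // !addr0. Qed.

(** Bundled as a linear map so that [unshuf_linear] can carry it through a coproduct. *)
Definition headlin L b l (hL : lmultilin L) : {linear A -> A} :=
  HB.pack (fun x => L (mktag b x :: l)) (GRing.isLinear.Build rat A A *:%R _ (@lmultilin_head L
    b l hL)).

Lemma lmultilin_cons L a : lmultilin L -> lmultilin (fun l => L (a :: l)).
Proof. by move=> h l1 b l2; exact: (h (a :: l1) b l2). Qed.
Lemma lsupersym_cons L a : lsupersym L -> lsupersym (fun l => L (a :: l)).
Proof. by move=> h l1 b c l2; exact: (h (a :: l1)). Qed.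

Lemma lmultilin_lin c L L' : lmultilin L -> lmultilin L' -> lmultilin (fun l => c *: L l + L' l).
Proof.
move=> h h' l1 b l2 k x y; rewrite h h' !scalerDr !scalerA (mulrC c) -!addrA.
by congr (_ + _); rewrite addrCA.
Qed.
Lemma lsupersym_lin c L L' : lsupersym L -> lsupersym L' -> lsupersym (fun l => c *: L l + L' l).
Proof. by move=> h h' l1 a b l2; rewrite h h' scalerDr !scalerA mulrC. Qed.
Lemma lmultilin_0 : lmultilin (fun _ => 0).
Proof. by move=> l1 b l2 k x y; rewrite scaler0 addr0. Qed.
Lemma lsupersym_0 : lsupersym (fun _ => 0).
Proof. by move=> l1 a b l2; rewrite scaler0. Qed.

Lemma unshuf_lmultilin K : (forall y, lmultilin (K^~ y)) -> (forall x, lmultilin (K x)) ->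
  lmultilin (fun l => unshuf l K).
Proof.
move=> h1 h2 l1 b l2; elim: l1 K h1 h2 => [|a l1 IH] K h1 h2 k x y /=.
  rewrite scalerDr addrACA; congr (_ + _); rewrite -unshufZ -unshufD; apply: eq_unshuf => p q _ _.
    exact: (h1 _ [::]).
  rewrite (h2 _ [::]) scalerDr !scalerA; congr (_ + _).
  by rewrite mulrC.
rewrite scalerDr addrACA; congr (_ + _).
  by rewrite IH //= => q l3; exact: (h1 _ (a :: l3)).
rewrite IH //= => [q|p] l3 b' l4 k' x' y' /=.
  rewrite h1 !seq_par_cat /= scalerDr !scalerA; congr (_ *: _ + _).
  by rewrite mulrC.
by rewrite (h2 _ (a :: l3)) scalerDr !scalerA mulrC.
Qed.

(** Once the two exchanged entries are at the front, there are four ways to place them: both left or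
    both right uses the supersymmetry of [K], and the two mixed placements are swapped with each
    other. *)
Lemma unshuf_lsupersym K : (forall y, lsupersym (K^~ y)) -> (forall x, lsupersym (K x)) ->
  lsupersym (fun l => unshuf l K).
Proof.
move=> h1 h2 l1; elim: l1 K h1 h2 => [|d l1 IH] K h1 h2 a c l2 /=.
  rewrite !scalerDr -!unshufZ -!addrA; congr (_ + _).
    by apply: eq_unshuf => x y _ _; rewrite (h1 _ [::]).
  rewrite addrCA; congr (_ + _); last congr (_ + _).
  - apply: eq_unshuf => x y _ _ /=; rewrite scalerA -signr_addb; congr (_ ^+ _ *: _).
    by case: (tpar a); case: (tpar c); case: (seq_par x).
  - apply: eq_unshuf => x y _ _ /=; rewrite scalerA -signr_addb; congr (_ ^+ _ *: _).
    by case: (tpar a); case: (tpar c); case: (seq_par x).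
  - apply: eq_unshuf => x y _ _ /=; have /= -> := h2 x [::] a c y.
    rewrite !scalerA -!signr_addb; congr (_ ^+ _ *: _).
    by case: (tpar a); case: (tpar c); case: (seq_par x).
rewrite scalerDr; congr (_ + _).
  by apply: (IH (fun x y => K (d :: x) y)) => // y l3; exact: (h1 y (d :: l3)).
apply: (IH (fun x y => (-1) ^+ (tpar d && seq_par x) *: K x (d :: y))) => [y|x] l3 a' c' l4.
  rewrite h1 !seq_par_cat /= !scalerA mulrC.
  by congr (_ * (_ ^+ (_ && _)) *: _); congr (_ (+) _); rewrite addbCA.
by rewrite (h2 _ (d :: l3)) !scalerA mulrC.
Qed.

(** * The insertion product and its pre-Lie identity *)

Definition lparity b L := forall l, hcomp (b (+) seq_par l) (L l) = L l.

Lemma unshuf_hcomp l b K : (forall x y, seq_par x (+) seq_par y = seq_par l ->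
  hcomp b (K x y) = K x y) ->
  hcomp b (unshuf l K) = unshuf l K.
Proof. by move=> h; rewrite unshuf_linear; apply: eq_unshuf => x y _ p; exact: h. Qed.

(* Only the component of parity [b] of [G] contributes, as [mktag] projects. *)
Definition lbarwedge b F G : seq T -> A :=
  fun l => unshuf l (fun x y => F (mktag (b (+) seq_par x) (G x) :: y)).

Lemma lbarwedge_lmultilin b F G : lmultilin F -> lmultilin G -> lmultilin (lbarwedge b F G).
Proof.
move=> hF hG; apply: unshuf_lmultilin => [y|x] l1 c l2 k u v; last exact: (hF (_ :: l1)).
by rewrite !seq_par_cat /= hG (lmultilin_head _ _ hF).
Qed.

Lemma lbarwedge_lsupersym b F G : lmultilin F -> lsupersym F -> lsupersym G ->
  lsupersym (lbarwedge b F G).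
Proof.
move=> hFM hF hG; apply: unshuf_lsupersym => [y|x] l1 a c l2; last exact: (hF (_ :: l1)).
rewrite hG (lmultilinZ [::]) // !seq_par_cat /=; congr (_ *: F (mktag _ _ :: _)).
by congr (_ (+) (_ (+) _)); rewrite addbCA.
Qed.

Lemma lbarwedge_lparity a b F G : lparity a F -> lparity (a (+) b) (lbarwedge b F G).
Proof.
move=> hF l; apply: unshuf_hcomp => x y <-.
rewrite -[in RHS]hF /=; congr (hcomp _ (F _)).
by case: a {hF}; case: b; case: (seq_par x); case: (seq_par y).
Qed.

Lemma lbarwedge_linl b F F' c G l :
  lbarwedge b (fun l => c *: F l + F' l) G l = c *: lbarwedge b F G l + lbarwedge b F' G l.
Proof. by rewrite /lbarwedge unshufD unshufZ. Qed.

Lemma lbarwedge_linr b F G c G' l : lmultilin F ->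
  lbarwedge b F (fun l => c *: G l + G' l) l = c *: lbarwedge b F G l + lbarwedge b F G' l.
Proof.
move=> hF; rewrite /lbarwedge -unshufZ -unshufD; apply: eq_unshuf => x y _ _.
exact: (lmultilin_head _ _ hF).
Qed.

Lemma lbarwedge_0l b G l : lbarwedge b (fun=> 0) G l = 0.
Proof. exact: unshuf0. Qed.
Lemma lbarwedge_0r b F l : lmultilin F -> lbarwedge b F (fun=> 0) l = 0.
Proof. by move=> hF; rewrite -[RHS](unshuf0 l); apply: eq_unshuf => x y _ _;
  exact: (lmultilin0 [::]). Qed.

Lemma lbarwedge_nil b F G : lmultilin F -> G [::] = 0 -> lbarwedge b F G [::] = 0.
Proof. by move=> hF hG; rewrite /lbarwedge /= hG (lmultilin0 [::]). Qed.

(** In the associator the terms with [H] nested inside [G] cancel by coassociativity; there remain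
    those in which the values of [G] and [H] occupy separate entries of [F]. *)
Lemma lbarwedge_assoc g h F G H l : lmultilin F ->
  lbarwedge h (lbarwedge g F G) H l - lbarwedge (g (+) h) F (lbarwedge h G H) l =
  unshuf l (fun x y => unshuf y (fun p q => (-1) ^+ ((h (+) seq_par x) && seq_par p) *:
    F (mktag (g (+) seq_par p) (G p) :: mktag (h (+) seq_par x) (H x) :: q))).
Proof.
move=> hF; rewrite {1}/lbarwedge /lbarwedge /= unshufD.
rewrite (unshuf_coassoc l (fun x p q =>
  F (mktag (g (+) seq_par (mktag (h (+) seq_par x) (H x) :: p)) (G (mktag (h (+) seq_par x) (H
    x) :: p)) :: q))).
rewrite addrAC -[RHS]add0r; congr (_ + _); apply/eqP; rewrite subr_eq0; apply/eqP.
apply: eq_unshuf => x y _ _.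
(* [F] is linear in its head, so the inner coproduct can be pulled out of it. *)
apply/esym; apply: etrans (unshuf_linear (headlin (g (+) h (+) seq_par x) y hF) x _) _.
apply: eq_unshuf => p q _ <- /=; congr (F (mktag _ _ :: _)).
by rewrite -!addbA.
Qed.

(** The associator is graded symmetric in [G] and [H]: cocommutativity exchanges their sublists and
    supersymmetry of [F] exchanges their values. *)
Lemma lbarwedge_prelie g h F G H l : lmultilin F -> lsupersym F ->
  lbarwedge h (lbarwedge g F G) H l - lbarwedge (g (+) h) F (lbarwedge h G H) l =
  (-1) ^+ (g && h) *: (lbarwedge g (lbarwedge h F H) G l - lbarwedge (g (+) h) F (lbarwedge g H
    G) l).
Proof.
move=> hM hS; rewrite lbarwedge_assoc // (addbC g h) lbarwedge_assoc // -unshufZ unshuf_comm12.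
apply: eq_unshuf => x y _ _; rewrite -unshufZ; apply: eq_unshuf => p q _ _.
rewrite (hS [::]) /= !scalerA -!signr_addb; congr (_ ^+ _ *: _).
by case: g; case: h; case: (seq_par x); case: (seq_par p).
Qed.

(** * Convolution and its powers *)

Definition conv F G : seq T -> A := fun l => unshuf l (fun x y => smul (F x) (G y)).

Lemma conv_lmultilin F G : lmultilin F -> lmultilin G -> lmultilin (conv F G).
Proof.
move=> hF hG; apply: unshuf_lmultilin => [y|x] l1 b l2 k u v /=.
  by rewrite hF smulDl smulZl.
by rewrite hG linearD linearZ.
Qed.

Lemma conv_lsupersym F G : lsupersym F -> lsupersym G -> lsupersym (conv F G).
Proof.
move=> hF hG; apply: unshuf_lsupersym => [y|x] l1 a c l2 /=.
  by rewrite hF smulZl.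
by rewrite hG linearZ.
Qed.

Lemma conv_lparity F G : lparity false F -> lparity false G -> lparity false (conv F G).
Proof.
move=> hF hG l; apply: unshuf_hcomp => x y /= <-.
by rewrite -hF -hG /= smul_graded.
Qed.

(** Coassociativity of the coproduct combined with associativity of [smul]. *)
Lemma convA F G H : conv F (conv G H) = conv (conv F G) H.
Proof.
apply: funext => l; rewrite /conv.
under eq_unshuf => x y _ _ do rewrite (unshuf_linear (smul (F x))).
rewrite (unshuf_coassoc l (fun x p q => smul (F x) (smul (G p) (H q)))).
apply: eq_unshuf => x y _ _.
have lin : linear (fun u => smul u (H y)) by exact: smul_is_linearl.
pose g : {linear A -> A} := HB.pack (fun u => smul u (H y))
  (GRing.isLinear.Build rat A A *:%R _ lin).
apply/esym; apply: etrans (unshuf_linear g x _) _.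
by apply: eq_unshuf => p q _ _; exact/esym/smulA.
Qed.

Lemma convZr c F G l : conv F (fun l => c *: G l) l = c *: conv F G l.
Proof. by rewrite /conv -unshufZ; apply: eq_unshuf => x y _ _; rewrite linearZ. Qed.

(** Inserting the even part of [G] is a derivation of the convolution: the inserted value goes to
    the first or to the second factor. *)
Lemma lbarwedge_conv F F' G l :
  lbarwedge false (conv F F') G l =
  conv (lbarwedge false F G) F' l + conv F (lbarwedge false F' G) l.
Proof.
rewrite /lbarwedge /conv /= unshufD; congr (_ + _).
  rewrite (unshuf_coassoc l (fun x p q => smul (F (mktag (seq_par x) (G x) :: p)) (F' q))).
  apply: eq_unshuf => x y _ _.
  have lin : linear (fun u => smul u (F' y)) by exact: smul_is_linearl.
  pose g : {linear A -> A} := HB.pack (fun u => smul u (F' y))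
    (GRing.isLinear.Build rat A A *:%R _ lin).
  exact: esym (unshuf_linear g x _).
(* In the second term the value of [G] has passed the entries given to [F]; being of the parity of
   [x], it produced the same sign as the exchange of sublists, and the two cancel. *)
rewrite unshuf_comm12; apply: eq_unshuf => x y _ _; rewrite (unshuf_linear (smul (F x))).
apply: eq_unshuf => p q _ _; rewrite /= scalerA -signr_addb.
by case: (seq_par x); case: (seq_par p); rewrite scale1r.
Qed.

Definition liden : seq T -> A := fun l => if l is [:: a] then tval a else 0.

Lemma liden_lmultilin : lmultilin liden.
Proof.
move=> [|a [|a' l1]] b [|c l2] k x y; rewrite /= ?scaler0 ?addr0 //.
exact: hcomp_linear.
Qed.
Lemma liden_lsupersym : lsupersym liden.
Proof. by move=> [|a [|a' l1]] b c l2; rewrite /= ?scaler0. Qed.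
Lemma liden_lparity : lparity false liden.
Proof. by move=> [|a [|b l]]; rewrite /= ?linear0 // addbF tval_hcomp. Qed.

Lemma lbarwedge_liden_l b G l : lbarwedge b liden G l = hcomp (b (+) seq_par l) (G l).
Proof.
rewrite -[RHS](unshuf_nilr l (fun l => hcomp (b (+) seq_par l) (G l))).
by apply: eq_unshuf => x [|c y].
Qed.

(** Splitting off a singleton means choosing the entry [j]; the sign is that of moving it to the
    front. *)
Lemma unshuf_single l (K : T -> seq T -> A) :
  unshuf l (fun x y => if x is [:: a] then K a y else 0) =
  \sum_(j < size l) (-1) ^+ (tpar (nth (mktag false 0) l j) && seq_par (take j l)) *:
    K (nth (mktag false 0) l j) (take j l ++ drop j.+1 l).
Proof.
elim: l K => [|c l IH] K /=; first by rewrite big_ord0.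
rewrite big_ord_recl /= andbF scale1r; congr (_ + _).
  rewrite drop0 -[RHS](unshuf_nill l (fun y => K c y)).
  by apply: eq_unshuf => -[|? ?] y.
rewrite (eq_unshuf (K' := fun x y => if x is [:: a] then
  (-1) ^+ (tpar c && tpar a) *: K a (c :: y) else 0)); last first.
  by move=> [|a [|b x]] y _ _ /=; rewrite ?scaler0 // addbF.
rewrite IH; apply: eq_bigr => j _; rewrite scalerA -signr_addb; congr (_ ^+ _ *: _).
by rewrite /=; case: (tpar c); case: (tpar _); case: (seq_par _).
Qed.

(** An Euler operator: each entry in turn is moved to the front and, by supersymmetry, gives back
    [G l], so the entries are counted. *)
Lemma lbarwedge_liden_r G l : lmultilin G -> lsupersym G ->
  lbarwedge false G liden l = (size l)%:R *: G l.
Proof.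
move=> hM hS; rewrite /lbarwedge /=.
rewrite (eq_unshuf (K' := fun x y => if x is [:: a] then G (a :: y) else 0)); last first.
  move=> [|a [|b x]] y _ _ /=; try exact: (lmultilin0 [::]).
  by rewrite addbF mktagE.
elim: l G hM hS => [|c l IH] G hM hS /=; first by rewrite scale0r.
rewrite -[in RHS]addn1 natrD scalerDl scale1r addrC; congr (_ + _).
  rewrite -(IH _ (lmultilin_cons c hM) (lsupersym_cons c hS)).
  apply: eq_unshuf => -[|a [|b x]] y _ _ /=; rewrite ?scaler0 //.
  by rewrite addbF; have /= -> := hS [::] c a y.
by rewrite -[RHS](unshuf_nill l (fun y => G (c :: y))); apply: eq_unshuf => -[|? ?] y.
Qed.

(* The exponent is n + 1: the convolution has no unit. *)
Fixpoint conv_pow n : seq T -> A := if n is n'.+1 then conv liden (conv_pow n') else liden.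

Lemma conv_pow_lmultilin n : lmultilin (conv_pow n).
Proof. by elim: n => [|n IH]; [exact: liden_lmultilin | apply: conv_lmultilin => //;
  exact: liden_lmultilin]. Qed.
Lemma conv_pow_lsupersym n : lsupersym (conv_pow n).
Proof. by elim: n => [|n IH]; [exact: liden_lsupersym | apply: conv_lsupersym => //;
  exact: liden_lsupersym]. Qed.
Lemma conv_pow_lparity n : lparity false (conv_pow n).
Proof. by elim: n => [|n IH]; [exact: liden_lparity | apply: conv_lparity => //;
  exact: liden_lparity]. Qed.

Lemma conv_pow_size n l : size l != n.+1 -> conv_pow n l = 0.
Proof.
elim: n l => [|n IH] l hl; first by case: l hl => [|a [|b l]].
rewrite /= /conv -[RHS](unshuf0 l); apply: eq_unshuf => -[|a [|b x]] y sz _ /=;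
  rewrite ?smul0l //.
by rewrite IH ?linear0 //; apply: contra hl => /eqP sy; rewrite -sz sy.
Qed.

Lemma conv_conv_pow i j : conv (conv_pow i) (conv_pow j) = conv_pow (i + j).+1.
Proof. by elim: i => //= i IH; rewrite -convA IH. Qed.

(** The derivation sends [liden] to [conv_pow m]; as powers of one element can be regrouped, its
    Leibniz rule on a product of n + 1 factors yields n + 1 equal terms. *)
Lemma lbarwedge_conv_pow n m l : lbarwedge false (conv_pow n) (conv_pow m) l = n.+1%:R *:
  conv_pow (n + m) l.
Proof.
elim: n l => [|n IH] l; first by rewrite lbarwedge_liden_l /= conv_pow_lparity scale1r.
rewrite [conv_pow n.+1]/= lbarwedge_conv (_ : lbarwedge false liden (conv_pow m) = conv_pow m);
  last first.
  by apply: funext => l'; rewrite lbarwedge_liden_l conv_pow_lparity.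
rewrite (_ : lbarwedge false (conv_pow n) (conv_pow m) = fun l =>
  n.+1%:R *: conv_pow (n + m) l); last first.
  exact: funext.
rewrite conv_conv_pow convZr addSn (addnC m) -[conv liden _]/(conv_pow (n + m).+1).
by rewrite -[in RHS]addn1 natrD scalerDl scale1r addrC.
Qed.

(** * Parity components and the bracket on lists *)

Definition lpart b L : seq T -> A := fun l => hcomp (b (+) seq_par l) (L l).

Lemma lpart_lmultilin b L : lmultilin L -> lmultilin (lpart b L).
Proof. by move=> h l1 c l2 k x y; rewrite /lpart h linearP !seq_par_cat. Qed.
Lemma lpart_lsupersym b L : lsupersym L -> lsupersym (lpart b L).
Proof.
move=> h l1 a c l2; rewrite /lpart h linearZ !seq_par_cat /=; congr (_ *: hcomp _ _).
by congr (_ (+) (_ (+) _)); rewrite addbCA.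
Qed.
Lemma lpart_lparity b L : lparity b (lpart b L).
Proof. by move=> l; rewrite /lpart hcompK eqxx. Qed.
Lemma lpartD L l : lpart false L l + lpart true L l = L l.
Proof.
rewrite /lpart; case: (seq_par l); rewrite /= ?hcompD //.
by rewrite addrC hcompD.
Qed.
Lemma lpart_id b L : lparity b L -> lpart b L = L.
Proof. by move=> h; apply: funext => l; exact: h. Qed.
Lemma lpart_neq a b L : a != b -> lparity b L -> lpart a L = fun=> 0.
Proof.
move=> ab h; apply: funext => l; rewrite /lpart -h hcompK.
by rewrite (negbTE (_ : a (+) seq_par l != b (+) seq_par l)) //; move: ab; case: a;
  case: b {h}; case: (seq_par l).
Qed.
Lemma lpart_lin b c L L' l :
  lpart b (fun l => c *: L l + L' l) l = c *: lpart b L l + lpart b L' l.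
Proof. by rewrite /lpart linearP. Qed.

(** List counterpart of [nr_bracket]; each [lbarwedge] is indexed by the parity of its inner
    function. *)
Definition lbracket F G : seq T -> A := fun l =>
  \sum_(a : bool) \sum_(b : bool)
    (lbarwedge b (lpart a F) (lpart b G) l
     - (-1) ^+ (a && b) *: lbarwedge a (lpart b G) (lpart a F) l).

Lemma lmultilin_sum (I : Type) (r : seq I) (L : I -> seq T -> A) :
  (forall i, lmultilin (L i)) -> lmultilin (fun l => \sum_(i <- r) L i l).
Proof.
move=> h; elim: r => [|i r IH].
  by move=> l1 b l2 k x y; rewrite !big_nil scaler0 addr0.
move=> l1 b l2 k x y; rewrite !big_cons h IH scalerDr -!addrA; congr (_ + _).
by rewrite addrCA.
Qed.
Lemma lsupersym_sum (I : Type) (r : seq I) (L : I -> seq T -> A) :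
  (forall i, lsupersym (L i)) -> lsupersym (fun l => \sum_(i <- r) L i l).
Proof.
by move=> h l1 a c l2; rewrite scaler_sumr; apply: eq_bigr => i _; exact: h.
Qed.

Lemma lmultilin_sub c L L' : lmultilin L -> lmultilin L' -> lmultilin (fun l => L l - c *: L' l).
Proof.
move=> h h'; rewrite (_ : (fun l => _) = (fun l => (- c) *: L' l + L l)).
  exact: lmultilin_lin.
by apply: funext => l; rewrite scaleNr addrC.
Qed.
Lemma lsupersym_sub c L L' : lsupersym L -> lsupersym L' -> lsupersym (fun l => L l - c *: L' l).
Proof.
move=> h h'; rewrite (_ : (fun l => _) = (fun l => (- c) *: L' l + L l)).
  exact: lsupersym_lin.
by apply: funext => l; rewrite scaleNr addrC.
Qed.

Lemma lbracket_lmultilin F G : lmultilin F -> lmultilin G -> lmultilin (lbracket F G).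
Proof.
move=> hF hG; do 2!apply: lmultilin_sum => ?.
by apply: lmultilin_sub; apply: lbarwedge_lmultilin; exact: lpart_lmultilin.
Qed.
Lemma lbracket_lsupersym F G : lmultilin F -> lmultilin G -> lsupersym F -> lsupersym G ->
  lsupersym (lbracket F G).
Proof.
move=> hF hG sF sG; do 2!apply: lsupersym_sum => ?.
by apply: lsupersym_sub; apply: lbarwedge_lsupersym;
  (exact: lpart_lmultilin || exact: lpart_lsupersym).
Qed.
Lemma lbracket_nil F G : lmultilin F -> lmultilin G -> F [::] = 0 -> G [::] = 0 ->
  lbracket F G [::] = 0.
Proof.
move=> hF hG F0 G0; apply: big1 => a _; apply: big1 => b _.
by rewrite !lbarwedge_nil ?scaler0 ?subr0 ?/lpart ?F0 ?G0 ?linear0 //; exact: lpart_lmultilin.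
Qed.

(** For homogeneous functions only one of the four pairs of parities has nonzero parts. *)
Lemma lbracket_hom a b F G l : lmultilin F -> lmultilin G -> lparity a F -> lparity b G ->
  lbracket F G l = lbarwedge b F G l - (-1) ^+ (a && b) *: lbarwedge a G F l.
Proof.
move=> hF hG pF pG; rewrite /lbracket (bigD1 a) //= (bigD1 b) //= !lpart_id //.
rewrite big1 ?addr0 => [|b' nb]; last first.
  by rewrite (lpart_neq nb pG) lbarwedge_0r // lbarwedge_0l scaler0 subr0.
rewrite big1 ?addr0 // => a' na; apply: big1 => b' _.
by rewrite (lpart_neq na pF) lbarwedge_0l lbarwedge_0r ?scaler0 ?subr0 //; exact: lpart_lmultilin.
Qed.

Lemma lbracket_linl c F F' G l : lmultilin G ->
  lbracket (fun l => c *: F l + F' l) G l = c *: lbracket F G l + lbracket F' G l.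
Proof.
move=> hG; rewrite /lbracket scaler_sumr -big_split; apply: eq_bigr => a _.
rewrite scaler_sumr -big_split; apply: eq_bigr => b _ /=.
rewrite (_ : lpart a (fun l => c *: F l + F' l) = fun l => c *: lpart a F l + lpart a F' l);
  last by apply: funext => l'; exact: lpart_lin.
rewrite lbarwedge_linl lbarwedge_linr; last exact: lpart_lmultilin.
rewrite !scalerDr scalerN opprD !scalerA (mulrC c) !addrA; congr (_ + _).
by rewrite addrAC.
Qed.

Lemma lbracket_linr c F G G' l : lmultilin F ->
  lbracket F (fun l => c *: G l + G' l) l = c *: lbracket F G l + lbracket F G' l.
Proof.
move=> hG; rewrite /lbracket scaler_sumr -big_split; apply: eq_bigr => a _.
rewrite scaler_sumr -big_split; apply: eq_bigr => b _ /=.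
rewrite (_ : lpart b (fun l => c *: G l + G' l) = fun l => c *: lpart b G l + lpart b G' l);
  last by apply: funext => l'; exact: lpart_lin.
rewrite lbarwedge_linl lbarwedge_linr; last exact: lpart_lmultilin.
rewrite !scalerDr scalerN opprD !scalerA (mulrC c) !addrA; congr (_ + _).
by rewrite addrAC.
Qed.

End ListFunctions.

(* Proves identities of abelian groups in which, after moving everything to the
   left, each atom occurs once with each sign. *)
Ltac zcancel :=
  apply/eqP; rewrite -subr_eq0 ?opprD ?opprK ?addrA -[eqbLHS]add0r ?addrA; apply/eqP;
  repeat match goal with
  | |- _ + - ?x = 0 => repeat rewrite [in LHS](addrAC _ x); rewrite subrK
  | |- _ + ?x = 0 => repeat rewrite [in LHS](addrAC _ (- x)); rewrite addrK
  end; try reflexivity.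

(** * The Jacobi identity and the brackets of the symmetrized products *)

Section Jacobi.
Variable A : superAlgType.
Local Notation T := (tagged_elt A).
Implicit Types L F G M : seq T -> A.

(** Put in the shape of a scalar multiple plus a function, to which the bilinearity lemmas apply. *)
Lemma lbracket_hom_fun a b F G : lmultilin F -> lmultilin G -> lparity a F -> lparity b G ->
  lbracket F G = fun l => (- (-1) ^+ (a && b)) *: lbarwedge a G F l + lbarwedge b F G l.
Proof.
by move=> *; apply: funext => l; rewrite (@lbracket_hom _ a b) // scaleNr addrC.
Qed.

Lemma lparity_lin b c L L' : lparity b L -> lparity b L' -> lparity b (fun l => c *: L l + L' l).
Proof. by move=> h h' l; rewrite linearP; congr (_ *: _ + _); [exact: h | exact: h']. Qed.

Lemma lbracket_lparity a b F G : lmultilin F -> lmultilin G -> lparity a F -> lparity b G ->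
  lparity (a (+) b) (lbracket F G).
Proof.
move=> mF mG hF hG; rewrite (lbracket_hom_fun mF mG hF hG).
by apply: lparity_lin; [rewrite addbC|]; exact: lbarwedge_lparity.
Qed.

(** As for any graded pre-Lie product, the commutator satisfies the Jacobi identity; [M] being even,
    bracketing with it is a derivation without signs. *)
Lemma lbracket_jacobi_hom a b M F G l : lmultilin M -> lmultilin F -> lmultilin G ->
  lsupersym M -> lsupersym F -> lsupersym G ->
  lparity false M -> lparity a F -> lparity b G ->
  lbracket M (lbracket F G) l = lbracket (lbracket M F) G l + lbracket F (lbracket M G) l.
Proof.
move=> mM mF mG sM sF sG pM pF pG.
have mFG := lbracket_lmultilin mF mG; have pFG := lbracket_lparity mF mG pF pG.
have mMF := lbracket_lmultilin mM mF; have pMF := lbracket_lparity mM mF pM pF.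
have mMG := lbracket_lmultilin mM mG; have pMG := lbracket_lparity mM mG pM pG.
rewrite (lbracket_hom l mM mFG pM pFG) (lbracket_hom l mMF mG pMF pG) (lbracket_hom l mF mMG pF
  pMG).
rewrite /= !scale1r (lbracket_hom_fun mF mG pF pG) (lbracket_hom_fun mM mF pM pF)
  (lbracket_hom_fun mM mG pM pG).
rewrite /= !lbarwedge_linl !lbarwedge_linr //.
(* One pre-Lie identity for each of the three functions in outermost place; after substitution all
   terms cancel in pairs. *)
have := lbarwedge_prelie a b F G l mM sM.
have := lbarwedge_prelie false b M G l mF sF.
have := lbarwedge_prelie false a M F l mG sG.
rewrite /= ?andbF /= ?expr0 ?scale1r ?addbF /= ?scaleN1r ?scaleNr.
set s := (-1) ^+ (a && b).
move=> /eqP; rewrite subr_eq => /eqP -> /eqP; rewrite subr_eq => /eqP -> /eqP.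
rewrite subr_eq => /eqP ->; rewrite !scalerDr !scalerN !scalerDr !scalerN.
do 20!(try move: (s *: lbarwedge _ _ _ _) => ?); do 20!(try move: (lbarwedge _ _ _ _) => ?).
zcancel.
Qed.

Lemma lpartD_fun L : L = fun l => 1 *: lpart false L l + lpart true L l.
Proof. by apply: funext => l; rewrite scale1r lpartD. Qed.

(** Both sides are bilinear in [F] and [G], which are decomposed into parity components: [G] inside
    [homF], then [F]. *)
Lemma lbracket_jacobi M F G : lmultilin M -> lmultilin F -> lmultilin G -> lsupersym M ->
  lsupersym F -> lsupersym G ->
  lparity false M -> lbracket M (lbracket F G) = fun l =>
    lbracket (lbracket M F) G l + lbracket F (lbracket M G) l.
Proof.
move=> mM mF mG sM sF sG pM.
have homF a F' G' : lmultilin F' -> lmultilin G' -> lsupersym F' -> lsupersym G' ->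
  lparity a F' ->
    lbracket M (lbracket F' G') = fun l =>
      lbracket (lbracket M F') G' l + lbracket F' (lbracket M G') l.
  move=> mF' mG' sF' sG' pF'.
  have m0 := lpart_lmultilin false mG'; have m1 := lpart_lmultilin true mG'.
  rewrite [G']lpartD_fun; set G0 := lpart false G'; set G1 := lpart true G'.
  have -> : lbracket F' (fun l => 1 *: G0 l + G1 l) = fun l =>
    1 *: lbracket F' G0 l + lbracket F' G1 l.
    by apply: funext => l; rewrite lbracket_linr.
  have -> : lbracket M (fun l => 1 *: G0 l + G1 l) = fun l =>
    1 *: lbracket M G0 l + lbracket M G1 l.
    by apply: funext => l; rewrite lbracket_linr.
  have jac b := @lbracket_jacobi_hom a b M F' (lpart b G') _ mM mF' (lpart_lmultilin b mG') sM sF'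
    (lpart_lsupersym b sG') pM pF' (lpart_lparity b G').
  apply: funext => l; rewrite !lbracket_linr //; try exact: lbracket_lmultilin.
  by rewrite !scale1r !jac addrACA.
have m0 := lpart_lmultilin false mF; have m1 := lpart_lmultilin true mF.
have H0 := homF false _ _ m0 mG (lpart_lsupersym _ sF) sG (lpart_lparity _ _).
have H1 := homF true _ _ m1 mG (lpart_lsupersym _ sF) sG (lpart_lparity _ _).
rewrite [F]lpartD_fun; set F0 := lpart false F in H0 *; set F1 := lpart true F in H1 *.
have -> : lbracket (fun l => 1 *: F0 l + F1 l) G = fun l =>
  1 *: lbracket F0 G l + lbracket F1 G l.
  by apply: funext => l; rewrite lbracket_linl.
have -> : lbracket M (fun l => 1 *: F0 l + F1 l) = fun l =>
  1 *: lbracket M F0 l + lbracket M F1 l.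
  by apply: funext => l; rewrite lbracket_linr.
apply: funext => l; rewrite lbracket_linr // H0 H1 !lbracket_linl //;
  last exact: lbracket_lmultilin.
by rewrite !scale1r addrACA.
Qed.

(** The list form of [mu]: the sum over all permutations is a convolution power, see
    [sum_perm_conv_pow] and [evalc_mu]. *)
Definition lmu n : seq T -> A := fun l => (n.+1)`!%:R^-1 *: conv_pow n l.

Lemma lin0 c L : (fun l => c *: L l) = fun l => c *: L l + 0.
Proof. by apply: funext => l; rewrite addr0. Qed.

Lemma lmu_lmultilin n : lmultilin (lmu n).
Proof. by rewrite /lmu lin0; apply: lmultilin_lin;
  [exact: conv_pow_lmultilin | exact: lmultilin_0]. Qed.
Lemma lmu_lsupersym n : lsupersym (lmu n).
Proof. by rewrite /lmu lin0; apply: lsupersym_lin;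
  [exact: conv_pow_lsupersym | exact: lsupersym_0]. Qed.
Lemma lmu_lparity n : lparity false (lmu n).
Proof. by move=> l; rewrite /lmu linearZ; congr (_ *: _); exact: conv_pow_lparity. Qed.
Lemma lmu_size n l : size l != n.+1 -> lmu n l = 0.
Proof. by move=> h; rewrite /lmu conv_pow_size ?scaler0. Qed.

Lemma lbarwedge_lmu n m l :
  lbarwedge false (lmu n) (lmu m) l =
  ((n.+1)`!%:R^-1 * (m.+1)`!%:R^-1 * n.+1%:R) *: conv_pow (n + m) l.
Proof.
rewrite /lmu (lin0 _ (conv_pow m)) lbarwedge_linr -?/(lmu n); last exact: lmu_lmultilin.
rewrite lbarwedge_0r ?addr0; last exact: lmu_lmultilin.
by rewrite /lmu lin0 lbarwedge_linl lbarwedge_0l addr0 lbarwedge_conv_pow !scalerA (mulrC _^-1).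
Qed.

(** Both insertion products are multiples of the same power, with factors n + 1 and m + 1, whose
    difference is n - m. *)
Lemma lbracket_lmu n m l : lbracket (lmu n) (lmu m) l =
  ((n%:R - m%:R) * ((n + m + 1)`!)%:R / (((n + 1)`!)%:R * ((m + 1)`!)%:R)) *: lmu (n + m) l.
Proof.
rewrite (lbracket_hom l (lmu_lmultilin n) (lmu_lmultilin m) (@lmu_lparity n) (@lmu_lparity m))
  !lbarwedge_lmu.
rewrite (addnC m) expr0 scale1r -scalerBl /lmu scalerA; congr (_ *: _).
rewrite !addn1.
have f0 k : (k`!)%:R != 0 :> rat by rewrite Num.Theory.pnatr_eq0 -lt0n fact_gt0.
rewrite -!natr1; field; rewrite !f0 //.
Qed.
End Jacobi.

(** * Sums over permutations and over splittings of a list *)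

Section Signs.

(** A product over all pairs can be split by removing one position, unlike the cardinality in the
    definition. *)
Lemma koszul_sign_prod N (s : 'S_N) par :
  koszul_sign s par =
  \prod_(i < N) \prod_(j < N) (-1) ^+ [&& (i < j)%N, (s j < s i)%N, par (s i) & par (s j)].
Proof.
rewrite /koszul_sign -prodr_const pair_big big_mkcond /=; apply: eq_bigr => -[i j] _.
by rewrite inE /=; case: ifP.
Qed.

Lemma eq_koszul_sign N (s : 'S_N) par par' :
  par =1 par' -> koszul_sign s par = koszul_sign s par'.
Proof.
move=> e; rewrite !koszul_sign_prod; do 2!(apply: eq_bigr => ? _).
by rewrite !e.
Qed.

Lemma lift_lt n (h : 'I_n) (i j : 'I_n.-1) : (lift h i < lift h j)%N = (i < j)%N.
Proof. by rewrite !ltnNge /= leq_bump2. Qed.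

(* The new inversions are the pairs formed by position [i], of value [j], and
   a position [k] that lies on different sides of them. *)
Lemma koszul_sign_lift N (i j : 'I_N.+1) (s : 'S_N) par :
  koszul_sign (lift_perm i j s) par =
  (\prod_(k < N) (-1) ^+ [&& par j, par (lift j (s k)) &
     (lift i k < i)%N (+) (lift j (s k) < j)%N])
  * koszul_sign s (par \o lift j).
Proof.
rewrite !koszul_sign_prod (bigD1_ord i) //= (bigD1_ord i) //=.
rewrite ltnn expr0 mul1r.
under [X in _ * X]eq_bigr => k _ do rewrite (bigD1_ord i) //=.
rewrite big_split /= mulrA -big_split /=; congr (_ * _); apply: eq_bigr => k _.
  rewrite !lift_perm_id !lift_perm_lift -signr_addb; congr (_ ^+ _).
  have := neq_lift i k; have := neq_lift j (s k); rewrite -!val_eqE /=.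
  case: (ltngtP (bump i k) i); case: (ltngtP (bump j (s k)) j) => //=;
  by case: (par j); case: (par _).
by apply: eq_bigr => k' _; rewrite !lift_perm_lift /= !ltnNge !leq_bump2.
Qed.

(** Deleting position [i] and its value leaves a permutation of the remaining indices. *)
Lemma lift_permP N (i : 'I_N.+1) (s : 'S_N.+1) : {s' | s = lift_perm i (s i) s'}.
Proof.
pose f k := odflt k (unlift (s i) (s (lift i k))).
have fK k : lift (s i) (f k) = s (lift i k).
  rewrite /f; have := neq_lift i k.
  by rewrite -(can_eq (permK s)) => /unlift_some[] ? ? ->.
have f_inj : injective f.
  by move=> k k' /(congr1 (lift (s i))); rewrite !fK => /perm_inj/lift_inj.
exists (perm f_inj); apply/permP => k; case: (unliftP i k) => [k'|] ->.
  by rewrite lift_perm_lift permE fK.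
by rewrite lift_perm_id.
Qed.

Lemma lift_perm_inj N (i j : 'I_N.+1) : injective (lift_perm i j).
Proof.
move=> s t e; apply/permP => k; apply: (@lift_inj _ j).
by rewrite -!(lift_perm_lift i) e.
Qed.

Lemma sum_perm_lift (V : nmodType) N (i : 'I_N.+1) (P : pred 'S_N.+1) (F : 'S_N.+1 -> V) :
  \sum_(s : 'S_N.+1 | P s) F s =
  \sum_(j < N.+1) \sum_(s : 'S_N | P (lift_perm i j s)) F (lift_perm i j s).
Proof.
rewrite (partition_big (fun s : 'S_N.+1 => s i) xpredT) //=; apply: eq_bigr => j _.
rewrite (reindex_onto (lift_perm i j) (fun s => sval (lift_permP i s))); last first.
  by move=> s /andP[_ /eqP <-]; rewrite -(svalP (lift_permP i s)).
apply: eq_bigl => s; case: lift_permP => s' e /=.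
move: e; rewrite lift_perm_id eqxx => /lift_perm_inj ->.
by rewrite eqxx !andbT.
Qed.

(** Here the sum is sorted by the position of a fixed value; passing to inverses reduces this to
    sorting by the value at a fixed position. *)
Lemma sum_perm_lift_inv (V : nmodType) N (j : 'I_N.+1) (P : pred 'S_N.+1) (F : 'S_N.+1 -> V) :
  \sum_(s : 'S_N.+1 | P s) F s =
  \sum_(i < N.+1) \sum_(s : 'S_N | P (lift_perm i j s)) F (lift_perm i j s).
Proof.
rewrite (reindex_inj invg_inj) (sum_perm_lift j) /=; apply: eq_bigr => i _.
rewrite (reindex_inj invg_inj); apply: eq_big => [s|s _]; by rewrite -lift_permV invgK.
Qed.

(** The least value of a shuffle stands at the beginning of one of the two increasing blocks, hence
    at place 0 (if the first block is nonempty) or at place [p]. *)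
Lemma shuffle_lift N p (i : 'I_N.+1) (s : 'S_N) : (p <= N.+1)%N ->
  shuffle p (lift_perm i ord0 s) =
  [&& i == 0%N :> nat, (0 < p)%N & shuffle p.-1 s] || ((i == p :> nat) && shuffle p s).
Proof.
move=> lepN; apply/idP/idP.
  move=> /forallP sh.
  have shE (a b : 'I_N.+1) : (a < b)%N -> (b < p)%N || (p <= a)%N ->
      (lift_perm i ord0 s a < lift_perm i ord0 s b)%N.
    by move=> ab h; have /forallP /(_ b) /implyP := sh a; apply; rewrite ab.
  (* Elsewhere the preceding place would lie in the same block and carry a value smaller than 0. *)
  have hi : (i == 0%N :> nat) || (i == p :> nat).
    apply/negPn/negP; rewrite negb_or => /andP[i0 ip].
    have lt : (i.-1 < N.+1)%N by have := ltn_ord i; lia.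
    have := shE (Ordinal lt) i; rewrite lift_perm_id /= ltn0 => H.
    by apply/notF/H => /=; lia.
  have shL (a b : 'I_N) : (a < b)%N -> (lift i b < p)%N || (p <= lift i a)%N -> (s a < s b)%N.
    move=> ab h; have := shE (lift i a) (lift i b).
    by rewrite !lift_perm_lift !lift_lt => /(_ ab h).
  have [ip|ip] := eqVneq (nat_of_ord i) p.
    apply/orP; right; apply/forallP => a; apply/forallP => b.
    apply/implyP => /andP[ab h]; apply: shL => //; rewrite /= ip /bump; lia.
  have i0 : i = 0%N :> nat by lia.
  have p0 : (0 < p)%N by lia.
  rewrite i0 p0 orbF; apply/forallP => a; apply/forallP => b.
  apply/implyP => /andP[ab h]; apply: shL => //; rewrite /= i0 /bump; lia.
move=> H; apply/forallP => a; apply/forallP => b; apply/implyP => /andP[ab h].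
case: (unliftP i a) ab h => [a'|] ->; case: (unliftP i b) => [b'|] ->;
  rewrite ?lift_perm_lift ?lift_perm_id ?ltnn //.
  rewrite !lift_lt => ab h; case/orP: H => [/and3P[/eqP i0 p0 /forallP/(_ a')/forallP/(_ b')]|].
    by rewrite ab /= => /implyP; apply; move: h; rewrite /= i0 /bump; lia.
  case/andP=> /eqP ip /forallP/(_ a')/forallP/(_ b').
  by rewrite ab /= => /implyP; apply; move: h; rewrite /= ip /bump; lia.
rewrite /= /bump; case: leqP => // ia ab h; exfalso.
case/orP: H => [/and3P[/eqP i0 p0 _]|/andP[/eqP ip _]]; lia.
Qed.

(** The two summands will match the two branches in the recursion of [unshuf]. *)
Lemma sum_shuffle_lift (V : nmodType) N p (F : 'S_N.+1 -> V) : (p <= N.+1)%N ->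
  \sum_(s : 'S_N.+1 | shuffle p s) F s =
  (if (0 < p)%N then \sum_(s : 'S_N | shuffle p.-1 s) F (lift_perm ord0 ord0 s) else 0)
  + (if (p <= N)%N then \sum_(s : 'S_N | shuffle p s) F (lift_perm (inord p) ord0 s) else 0).
Proof.
move=> lepN; rewrite (sum_perm_lift_inv ord0).
under eq_bigr => i _ do under eq_bigl => s do rewrite shuffle_lift //.
case: p lepN => [|p] lepN.
  rewrite add0r /= (bigD1 ord0) //= [X in _ + X]big1 ?addr0.
    have -> : inord 0 = ord0 :> 'I_N.+1 by apply: val_inj; rewrite /= inordK.
    by apply: eq_bigl.
  move=> i i0; apply: big1 => s; move: i0; rewrite -val_eqE /= => /negbTE ->.
  by rewrite andbF.
rewrite (bigD1 ord0) //=; congr (_ + _).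
  by apply: eq_bigl => s; rewrite orbF.
case pN: (p.+1 <= N)%N; last first.
  apply: big1 => i i0; apply: big1 => s /orP[/andP[/eqP e]|/andP[/eqP e]].
    by move: i0; rewrite -val_eqE /= e.
  by have := ltn_ord i; rewrite e; lia.
rewrite (bigD1 (inord p.+1)) /=; last by rewrite -val_eqE /= inordK.
rewrite [X in _ + X]big1 ?addr0.
  by apply: eq_bigl => s; rewrite inordK // eqxx.
move=> i /andP[i0 ip]; apply: big1 => s; move: i0 ip; rewrite -!val_eqE /= inordK //.
by move=> /negbTE -> /negbTE ->.
Qed.

End Signs.

(** * Lists indexed by ordinals, and the action of permutations on them *)

Section Lists.
Variable A : superAlgType.
Local Notation T := (tagged_elt A).
Local Notation t0 := (mktag false (0 : A)).
Implicit Types L : seq T -> A.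

Definition ord_seq N (h : 'I_N -> T) : seq T := [seq h i | i <- enum 'I_N].

Lemma size_ord_seq N (h : 'I_N -> T) : size (ord_seq h) = N.
Proof. by rewrite size_map size_enum_ord. Qed.

Lemma nth_ord_seq N (h : 'I_N -> T) (i : 'I_N) : nth t0 (ord_seq h) i = h i.
Proof. by rewrite (nth_map i) ?size_enum_ord // nth_ord_enum. Qed.

Lemma eq_ord_seq N (h h' : 'I_N -> T) : h =1 h' -> ord_seq h = ord_seq h'.
Proof. by move=> e; apply: eq_map. Qed.

Lemma ord_seqS N (h : 'I_N.+1 -> T) : ord_seq h = h ord0 :: ord_seq (h \o lift ord0).
Proof. by rewrite /ord_seq enum_ordSl /= -map_comp. Qed.

Lemma ord_seq_nth N l : size l = N -> ord_seq (fun i : 'I_N => nth t0 l i) = l.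
Proof.
move=> sl; apply: (@eq_from_nth _ t0); first by rewrite size_ord_seq.
by rewrite size_ord_seq => i iN; rewrite (nth_ord_seq _ (Ordinal iN)).
Qed.

(** Displays one entry between a prefix and a suffix, the form in which [lmultilin] and [lsupersym]
    can be applied. *)
Lemma ord_seq_lift N (h : 'I_N.+1 -> T) (i : 'I_N.+1) (w := ord_seq (h \o lift i)) :
  ord_seq h = take i w ++ h i :: drop i w.
Proof.
have iN : (i <= N)%N by rewrite -ltnS.
apply: (@eq_from_nth _ t0).
  by rewrite size_cat /= size_takel ?size_drop ?size_ord_seq // addnS subnKC.
rewrite size_ord_seq => k kN; rewrite (nth_ord_seq h (Ordinal kN)) nth_cat size_takel
  ?size_ord_seq //.
case: (unliftP i (Ordinal kN)) => [k'|] e; rewrite e.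
  have -> : k = bump i k' by exact: (congr1 val e).
  have k'E : h (lift i k') = nth t0 w k' by rewrite nth_ord_seq.
  rewrite k'E /bump; case: (leqP i k') => h1; last by rewrite h1 nth_take.
  rewrite ltnNge (leq_trans h1 (leqnSn _)) /= subSn //= nth_drop.
  by rewrite subnKC.
have -> : k = i by exact: (congr1 val e).
by rewrite ltnn subnn.
Qed.

Lemma ord_seq_lift_perm N (h : 'I_N.+1 -> T) (i j : 'I_N.+1) (s : 'S_N)
    (w := ord_seq (h \o lift j \o s)) :
  ord_seq (h \o lift_perm i j s) = take i w ++ h j :: drop i w.
Proof.
rewrite (ord_seq_lift _ i) /= lift_perm_id.
by rewrite (eq_ord_seq (h' := h \o lift j \o s)) // => k /=; rewrite lift_perm_lift.
Qed.

Lemma seq_par_ord_seq N (h : 'I_N ->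
  T) : seq_par (ord_seq h) = \big[addb/false]_(i < N) tpar (h i).
Proof.
elim: N h => [|N IH] h; first by rewrite big_ord0 /ord_seq enum_ord0.
by rewrite ord_seqS big_ord_recl /= IH.
Qed.

Lemma sign_take N (h : 'I_N -> T) c i :
  \prod_(k < N) (-1) ^+ [&& c, tpar (h k) & (k < i)%N] = (-1) ^+ (c && seq_par (take i (ord_seq
    h))) :> rat.
Proof.
elim: N i h => [|N IH] i h; first by rewrite big_ord0 /ord_seq enum_ord0 /= andbF.
rewrite ord_seqS big_ord_recl; case: i => [|i] /=.
  by rewrite !andbF big1 // => k _; rewrite !andbF.
rewrite (IH i (h \o lift ord0)) andbT -signr_addb.
by rewrite andb_addr.
Qed.

(** The entry of index 0, standing at place [i], is inverted exactly with the entries standing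
    before it. *)
Lemma sign_lift0r N (h : 'I_N.+1 -> T) i (s : 'S_N) :
  koszul_sign (lift_perm i ord0 s) (@tpar _ \o h) =
  (-1) ^+ (tpar (h ord0) && seq_par (take i (ord_seq (h \o lift ord0 \o s))))
  * koszul_sign s (@tpar _ \o (h \o lift ord0)).
Proof.
rewrite koszul_sign_lift -sign_take /=; congr (_ * _); apply: eq_bigr => k _.
congr (_ ^+ [&& _, _ & _]); rewrite addbF /= /bump; lia.
Qed.

(** The first place, holding index [j], is inverted exactly with the indices below [j]. *)
Lemma sign_lift0l N (h : 'I_N.+1 -> T) j (s : 'S_N) :
  koszul_sign (lift_perm ord0 j s) (@tpar _ \o h) =
  (-1) ^+ (tpar (h j) && seq_par (take j (ord_seq (h \o lift j))))
  * koszul_sign s (@tpar _ \o (h \o lift j)).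
Proof.
rewrite koszul_sign_lift -sign_take /= [in RHS](reindex_inj (@perm_inj _ s)) /=.
congr (_ * _); apply: eq_bigr => k _; congr (_ ^+ [&& _, _ & _]).
rewrite /bump; lia.
Qed.

(** Induction on the list: the place of index 0 in the shuffle decides which sublist the head
    joins. *)
Lemma sum_shuffle_unshuf N (h : 'I_N -> T) p (Q : seq T -> seq T -> A) : (p <= N)%N ->
  \sum_(s : 'S_N | shuffle p s) koszul_sign s (@tpar _ \o h) *:
     Q (take p (ord_seq (h \o s))) (drop p (ord_seq (h \o s))) =
  unshuf (ord_seq h) (fun x y => if size x == p then Q x y else 0).
Proof.
elim: N h p Q => [|N IH] h p Q pN.
  have -> : p = 0%N by lia.
  rewrite (big_pred1 1%g) => [|s]; last first.
    have -> : s = 1%g by apply/permP => -[].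
    by rewrite [RHS]eqxx; apply/forallP => -[].
  by rewrite {1 2 3}/ord_seq enum_ord0 /= koszul_sign_prod big_ord0 scale1r.
rewrite sum_shuffle_lift // [in RHS]ord_seqS /=; congr (_ + _).
  case: p pN => [|p] pN /=; first by rewrite unshuf0.
  rewrite -(IH _ _ (fun x y => Q (h ord0 :: x) y)) //.
  apply: eq_bigr => s _; rewrite sign_lift0r ord_seq_lift_perm /= take0 drop0 andbF mul1r.
  by [].
(* If p = N + 1 the second block is empty and the head cannot join it; the lengths then exclude
   every term of the coproduct. *)
case hp: (p <= N)%N; last first.
  rewrite -[LHS](unshuf0 (ord_seq (h \o lift ord0))); apply: eq_unshuf => x y.
  rewrite size_ord_seq => sz _; case: eqP => [e|_]; last by rewrite scaler0.
  by exfalso; lia.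
rewrite (eq_unshuf (K' := fun x y => if size x == p then
  (-1) ^+ (tpar (h ord0) && seq_par x) *: Q x (h ord0 :: y) else 0)); last first.
  by move=> x y _ _; case: ifP; rewrite ?scaler0.
rewrite -(IH _ _ (fun x y => (-1) ^+ (tpar (h ord0) && seq_par x) *: Q x (h ord0 :: y))) //.
apply: eq_bigr => s _; rewrite sign_lift0r ord_seq_lift_perm inordK //.
rewrite take_size_cat ?drop_size_cat ?size_takel ?size_ord_seq //.
by rewrite scalerA mulrC.
Qed.

Definition prodl (l : seq T) : A :=
  if l is a :: l' then foldl smul (tval a) [seq tval t | t <- l'] else 0.

Lemma prodl_cons a b l : prodl (a :: b :: l) = smul (tval a) (prodl (b :: l)).
Proof.
by rewrite /=; elim: l (tval b) => //= c l IH u; rewrite -IH smulA.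
Qed.

(** Choosing the first value of a permutation is splitting off a singleton for the leftmost factor
    [liden]; the rest is permuted by induction. *)
Lemma sum_perm_conv_pow n (h : 'I_n.+1 -> T) :
  \sum_(s : 'S_n.+1) koszul_sign s (@tpar _ \o h) *: prodl (ord_seq (h \o s)) = conv_pow n
    (ord_seq h).
Proof.
elim: n h => [|n IH] h.
  rewrite (big_pred1 1%g) => [|s]; last first.
    have -> : s = 1%g by apply/permP => i; rewrite !ord1.
    by rewrite [RHS]eqxx.
  rewrite koszul_sign_prod !ord_seqS /ord_seq enum_ord0 /= perm1.
  by rewrite !big_ord_recl !big_ord0 /= !mulr1 scale1r.
rewrite (sum_perm_lift ord0) /= /conv.
rewrite (eq_unshuf (K' := fun x y => if x is [:: a] then smul (tval a) (conv_pow n y) else 0));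
  last first.
  by move=> [|a [|b x]] y _ _ /=; rewrite ?smul0l.
rewrite (unshuf_single (ord_seq h) (fun a y => smul (tval a) (conv_pow n y))).
(* The bound [size (ord_seq h)] occurs in the type of the index; a range of natural numbers lets it
   be rewritten. *)
rewrite -(big_mkord xpredT (fun j =>
  (-1) ^+ (tpar (nth t0 (ord_seq h) j) && seq_par (take j (ord_seq h))) *:
  smul (tval (nth t0 (ord_seq h) j)) (conv_pow n (take j (ord_seq h) ++ drop j.+1 (ord_seq h))))).
rewrite size_ord_seq big_mkord; apply: eq_bigr => j _.
have jw : (j <= size (ord_seq (h \o lift j)))%N by rewrite size_ord_seq -ltnS.
rewrite nth_ord_seq (ord_seq_lift h j); set w := ord_seq (h \o lift j).
rewrite take_size_cat ?size_takel // -cat_rcons drop_size_cat ?size_rcons ?size_takel //.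
rewrite cat_take_drop -IH linear_sum scaler_sumr; apply: eq_bigr => s _.
rewrite sign_lift0l ord_seq_lift_perm take0 drop0 [_ ++ _]/= linearZ scalerA; congr (_ *: _).
by rewrite ord_seqS prodl_cons.
Qed.

Lemma lsupersym_front L l1 a l2 : lsupersym L ->
  L (l1 ++ a :: l2) = (-1) ^+ (tpar a && seq_par l1) *: L (a :: l1 ++ l2).
Proof.
elim: l1 L => [|c l1 IH] L hL /=; first by rewrite andbF scale1r.
rewrite (IH (fun l => L (c :: l))); last exact: lsupersym_cons.
have /= -> := hL [::] c a (l1 ++ l2); rewrite scalerA -signr_addb.
by congr (_ ^+ _ *: _); case: (tpar a); case: (tpar c); case: (seq_par l1).
Qed.

(** The entry of index 0 is brought to the front by adjacent swaps, and the tail is permuted by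
    induction. *)
Lemma lsupersym_perm N (h : 'I_N -> T) (s : 'S_N) L : lsupersym L ->
  L (ord_seq (h \o s)) = koszul_sign s (@tpar _ \o h) *: L (ord_seq h).
Proof.
elim: N h s L => [|N IH] h s L hL.
  by rewrite /ord_seq enum_ord0 koszul_sign_prod big_ord0 scale1r.
(* The inverse permutation gives the place at which index 0 stands. *)
have [s' ->] := lift_permP ((s^-1)%g ord0) s; rewrite permKV.
rewrite ord_seq_lift_perm lsupersym_front // cat_take_drop sign_lift0r -scalerA [in RHS]ord_seqS.
by rewrite (IH _ _ (fun l => L (h ord0 :: l))) //; exact: lsupersym_cons.
Qed.

End Lists.

(** * Cochains as functions on lists *)

Section Bridge.
Variable A : superAlgType.
Local Notation T := (tagged_elt A).
Local Notation t0 := (mktag false (0 : A)).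
Implicit Types L : seq T -> A.

Definition tag_seq N (par : {ffun 'I_N -> bool}) (v : {ffun 'I_N -> A}) : seq T :=
  ord_seq (fun i => mktag (par i) (v i)).

Lemma tval_mktag b (x : A) : tval (mktag b x) = hcomp b x. Proof. by []. Qed.

Lemma seq_par_tag_seq N (par : {ffun 'I_N -> bool}) (v : {ffun 'I_N -> A}) :
  seq_par (tag_seq par v) = par_sum par.
Proof. by rewrite seq_par_ord_seq. Qed.

Definition evalc n (f : cochain A n) : seq T -> A := fun l =>
  if size l == n.+1 then f [ffun i : 'I_n.+1 => tval (nth t0 l i)] else 0.

(** A whole sequence of cochains becomes one function, the length of the list selecting the
    component; length 0 belongs to no component and gets the value 0. *)
Definition evalL (F : cochains A) : seq T -> A := fun l =>
  if l is [::] then 0 else evalc (F (size l).-1) l.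

(** Inverse to [evalL]: arbitrary arguments are expanded into homogeneous ones by summing over all
    parities. *)
Definition cochains_of L : cochains A := fun n v => \sum_par L (tag_seq par v).
Arguments cochains_of : clear implicits.

Lemma evalLE F n l : size l = n.+1 -> evalL F l = evalc (F n) l.
Proof. by case: l => // t l /= [<-]. Qed.

Lemma evalc_tag_seq n (f : cochain A n) par v : evalc f (tag_seq par v) = f (args_comp par v).
Proof.
rewrite /evalc size_ord_seq eqxx; congr f; apply/ffunP => i.
by rewrite !ffunE nth_ord_seq tval_mktag.
Qed.

Lemma evalL_tag_seq F n (par : {ffun 'I_n.+1 ->
  bool}) v : evalL F (tag_seq par v) = F n (args_comp par v).
Proof. by rewrite (@evalLE _ n) ?evalc_tag_seq // size_ord_seq. Qed.

Lemma evalc_lmultilin n (f : cochain A n) : multilinear f -> lmultilin (evalc f).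
Proof.
move=> hf l1 b l2 k x y; rewrite /evalc !size_cat /=; case: eqP => [sz|_]; last first.
  by rewrite scaler0 addr0.
have lt : (size l1 < n.+1)%N by lia.
have upd z : [ffun i : 'I_n.+1 => tval (nth t0 (l1 ++ mktag b z :: l2) i)] =
    update [ffun i : 'I_n.+1 => tval (nth t0 (l1 ++ mktag b 0 :: l2) i)] (Ordinal lt) (hcomp b z).
  apply/ffunP => i; rewrite !ffunE !nth_cat -val_eqE /=.
  case: (ltngtP i (size l1)) => // [h|->]; last by rewrite subnn.
  by have -> : (i - size l1 = (i - size l1).-1.+1)%N by lia.
by rewrite upd linearP hf -!upd.
Qed.

Lemma koszul_sign_adj n (i j : 'I_n) par : j = i.+1 :> nat ->
  koszul_sign (tperm i j) par = (-1) ^+ (par i && par j).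
Proof.
move=> ij; rewrite /koszul_sign.
have -> : [set ab : 'I_n * 'I_n | [&& (ab.1 < ab.2)%N, (tperm i j ab.2 < tperm i j ab.1)%N,
    par (tperm i j ab.1) & par (tperm i j ab.2)]]%SET =
    if par i && par j then [set (i, j)]%SET else finset.set0.
  apply/setP => -[a b]; rewrite inE /=.
  have -> : ((a, b) \in if par i && par j then [set (i, j)]%SET else finset.set0) =
      [&& a == i, b == j, par i & par j].
    by case: (par i && par j); rewrite inE ?xpair_eqE ?andbT ?andbF.
  case: tpermP => [->|->|/eqP na /eqP na']; case: tpermP => [->|->|/eqP nb /eqP nb'];
    try (move: na na'); try (move: nb nb'); rewrite -!val_eqE /=; lia.
by case: (par i && par j); rewrite ?cards1 ?cards0.
Qed.

Lemma evalc_lsupersym n (f : cochain A n) : supersymmetric f -> lsupersym (evalc f).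
Proof.
move=> hf l1 a c l2; rewrite /evalc !size_cat /=; case: eqP => [sz|_]; last by rewrite scaler0.
have lt0 : (size l1 < n.+1)%N by lia.
have lt1 : ((size l1).+1 < n.+1)%N by lia.
pose i0 := Ordinal lt0; pose i1 := Ordinal lt1; set l := l1 ++ c :: a :: l2.
have := hf (tperm i0 i1) [ffun i : 'I_n.+1 => tpar (nth t0 l i)] [ffun i : 'I_n.+1 =>
  tval (nth t0 l i)].
rewrite koszul_sign_adj // !ffunE => H.
have nc : nth t0 l i0 = c by rewrite /l nth_cat /= ltnn subnn.
have na : nth t0 l i1 = a by rewrite /l nth_cat /= ltnNge leqnSn /= subSnn.
rewrite na nc andbC in H.
rewrite -{}H; last by move=> i; rewrite !ffunE; exact: tval_hcomp.
congr f; apply/ffunP => i; rewrite !ffunE; congr tval.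
case: tpermP => [->|->|/eqP n0 /eqP n1]; rewrite ?na ?nc.
- by rewrite nth_cat /= ltnn subnn.
- by rewrite nth_cat /= ltnNge leqnSn /= subSnn.
move: n0 n1; rewrite /l -!val_eqE /= !nth_cat => n0 n1.
case: ltnP => // h; have -> : (i - size l1 = (i - size l1).-2.+2)%N by lia.
by [].
Qed.

Lemma multilinearD n (f : cochain A n) i v x y : multilinear f ->
  f (update v i (x + y)) = f (update v i x) + f (update v i y).
Proof. by move=> hf; have := hf i v 1 x y; rewrite !scale1r. Qed.

(** The arguments are decomposed into even and odd parts one at a time. *)
Lemma multilinear_expand n (f : cochain A n) v : multilinear f ->
  f v = \sum_par f (args_comp par v).
Proof.
move=> hf.
(* The positions in [r] are already decomposed; [P] fixes the parity at all others to be even, so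
   that each term is counted once. *)
pose mix (r : seq 'I_n.+1) (par : {ffun 'I_n.+1 -> bool}) : {ffun 'I_n.+1 -> A} :=
  [ffun i => if i \in r then hcomp (par i) (v i) else v i].
pose P (r : seq 'I_n.+1) (par : {ffun 'I_n.+1 -> bool}) := [forall i, (i \notin r) ==> ~~ par i].
have H r : uniq r -> f v = \sum_(par | P r par) f (mix r par).
  elim: r => [_|i r IH /= /andP[ir ur]].
    rewrite (big_pred1 [ffun=> false]); last first.
      move=> par; apply/forallP/eqP => [h|-> j]; last by rewrite ffunE implybT.
      by apply/ffunP => j; have := h j; rewrite ffunE /= => /negbTE.
    by congr f; apply/ffunP => j; rewrite ffunE.
  rewrite (IH ur) [RHS](bigID (fun par : {ffun 'I_n.+1 -> bool} => par i)) /=.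
  (* Flipping the parity at [i] pairs the even and odd parts of the newly decomposed argument. *)
  pose flip (par : {ffun 'I_n.+1 -> bool}) : {ffun 'I_n.+1 -> bool} :=
    [ffun j => if j == i then ~~ par j else par j].
  have flipK : involutive flip.
    by move=> par; apply/ffunP => j; rewrite !ffunE; case: eqP => // _; rewrite negbK.
  rewrite addrC [X in _ = _ + X](reindex_inj (can_inj flipK)) /=.
  have P1 par : P r par = P (i :: r) par && ~~ par i.
    apply/forallP/andP => [h|[/forallP h pi] j].
      split; last by have := h i; rewrite ir.
      apply/forallP => j; apply/implyP; rewrite inE negb_or => /andP[_ jr].
      by have := h j; rewrite jr.
    have [->|ji] := eqVneq j i; first by rewrite pi implybT.
    by have := h j; rewrite inE negb_or ji.
  have P2 par : P (i :: r) (flip par) && flip par i = P r par.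
    rewrite P1 {2}/flip ffunE eqxx; congr (_ && _); apply: eq_forallb => j.
    by rewrite inE negb_or /flip ffunE; case: eqP => // ->.
  rewrite [X in _ = _ + X](eq_bigl _ _ P2) -[X in _ = X + _](eq_bigl _ _ P1) -big_split /=.
  apply: eq_bigr => par Pp.
  have pi : par i = false by move: Pp; rewrite P1 => /andP[_ /negbTE].
  have e0 : mix (i :: r) par = update (mix r par) i (hcomp false (v i)).
    apply/ffunP => j; rewrite !ffunE inE; case: eqP => [->|//].
    by rewrite pi.
  have e1 : mix (i :: r) (flip par) = update (mix r par) i (hcomp true (v i)).
    apply/ffunP => j; rewrite !ffunE inE; case: eqP => [->|ji] /=.
      by rewrite pi.
    by [].
  rewrite e0 e1 -multilinearD // hcompD; congr f; apply/ffunP => j.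
  by rewrite !ffunE; case: eqP => [->|//]; rewrite (negbTE ir).
rewrite (H (enum 'I_n.+1) (enum_uniq _)); apply: eq_big => par.
  by apply/forallP => j; rewrite mem_enum.
by move=> _; congr f; apply/ffunP => j; rewrite !ffunE mem_enum.
Qed.

Lemma evalc_size n (f : cochain A n) l : size l != n.+1 -> evalc f l = 0.
Proof. by rewrite /evalc => /negbTE ->. Qed.

Lemma evalL_lmultilin F : (forall n, multilinear (F n)) -> lmultilin (evalL F).
Proof.
move=> hF l1 b l2 k x y; pose n := (size l1 + size l2)%N.
have sz z : size (l1 ++ mktag b z :: l2) = n.+1 by rewrite size_cat /= addnS.
by rewrite !(@evalLE _ n) //; exact: evalc_lmultilin.
Qed.

Lemma evalL_lsupersym F : (forall n, supersymmetric (F n)) -> lsupersym (evalL F).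
Proof.
move=> hF l1 a c l2; pose n := (size l1 + (size l2).+1)%N.
have sz x y : size (l1 ++ x :: y :: l2) = n.+1 by rewrite size_cat /= addnS.
by rewrite !(@evalLE _ n) //; exact: evalc_lsupersym.
Qed.

Lemma cochains_of_evalL F n : multilinear (F n) -> cochains_of (evalL F) n = F n.
Proof.
move=> hF; apply: funext => v; rewrite [RHS]multilinear_expand //.
by apply: eq_bigr => par _; rewrite evalL_tag_seq.
Qed.

(* Only the parities of the entries of [l] contribute to the sum over [par]. *)
Lemma evalc_cochains_of L n l : lmultilin L -> size l = n.+1 -> evalc (cochains_of L n) l = L l.
Proof.
move=> hL sl; rewrite /evalc sl eqxx /cochains_of (bigD1 [ffun i : 'I_n.+1 =>
  tpar (nth t0 l i)]) //=.
rewrite [X in L X](_ : _ = l); last first.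
  rewrite -[RHS](ord_seq_nth sl); apply: eq_ord_seq => i; rewrite !ffunE.
  exact: mktagE.
rewrite big1 ?addr0 // => par; apply: contraNeq => H; apply/eqP/ffunP => i; rewrite ffunE.
apply/eqP; apply: contraR H => ni; apply/eqP; rewrite /tag_seq (ord_seq_lift _ i).
by rewrite ffunE mktag_neq //; exact: lmultilin0.
Qed.

Lemma evalL_cochains_of L : lmultilin L -> L [::] = 0 -> evalL (cochains_of L) = L.
Proof.
move=> hL L0; apply: funext => -[|t l]; first by rewrite L0.
by rewrite (@evalLE _ (size l)) // evalc_cochains_of.
Qed.

Lemma cochains_of_multilinear L n : lmultilin L -> multilinear (cochains_of L n).
Proof.
move=> hL i v k x y; rewrite /cochains_of scaler_sumr -big_split; apply: eq_bigr => par _ /=.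
pose w := ord_seq (fun j => mktag (par (lift i j)) (v (lift i j))).
have E z : tag_seq par (update v i z) = take i w ++ mktag (par i) z :: drop i w.
  rewrite /tag_seq (ord_seq_lift _ i) ffunE eqxx.
  rewrite (eq_ord_seq (h' := fun j => mktag (par (lift i j)) (v (lift i j)))) // => j /=.
  by rewrite ffunE eq_sym (negbTE (neq_lift _ _)).
by rewrite !E hL.
Qed.

Lemma cochains_of_homog L n (par : {ffun 'I_n.+1 -> bool}) (v : {ffun 'I_n.+1 ->
  A}) : lmultilin L -> homog_args par v ->
  cochains_of L n v = L (tag_seq par v).
Proof.
move=> hL hv; rewrite -[RHS](@evalc_cochains_of L n) ?size_ord_seq // evalc_tag_seq;
  congr (cochains_of L n _).
by apply/ffunP => i; rewrite ffunE hv.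
Qed.

Lemma cochains_of_Dn L n : lmultilin L -> lsupersym L -> Dn A n (cochains_of L n).
Proof.
move=> hM hS; split; first exact: cochains_of_multilinear.
move=> s par v hv; rewrite (@cochains_of_homog _ _ [ffun i => par (s i)]) //; last first.
  by move=> i; rewrite !ffunE; exact: hv.
rewrite (cochains_of_homog hM hv) /tag_seq.
rewrite (eq_ord_seq (h' := (fun i => mktag (par i) (v i)) \o s)); last by move=> i;
  rewrite /= !ffunE.
rewrite lsupersym_perm //; congr (_ *: _); exact: eq_koszul_sign.
Qed.

(** On a member of a family a cast is mere reindexing; writing cochains through [cochains_of] thus
    removes all casts. *)
Lemma cast_cochain_family (F : cochains A) n m (e : n = m) : cast_cochain e (F n) = F m.
Proof.
case: _ / e; apply: funext => v; congr (F n); apply/ffunP => i.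
by rewrite ffunE; congr (v _); apply: val_inj.
Qed.

Lemma evalc_part n (f : cochain A n) b : multilinear f ->
  cochain_part b f = cochains_of (lpart b (evalc f)) n.
Proof.
move=> hf; apply: funext => v; apply: eq_bigr => par _.
by rewrite /lpart evalc_tag_seq seq_par_tag_seq.
Qed.

Lemma evalc_cochain_part n (f : cochain A n) b : multilinear f ->
  evalc (cochain_part b f) = lpart b (evalc f).
Proof.
move=> hf; apply: funext => l; rewrite evalc_part //.
have [sl|nl] := eqVneq (size l) n.+1; last by rewrite /lpart !evalc_size // linear0.
by rewrite evalc_cochains_of //; apply: lpart_lmultilin; exact: evalc_lmultilin.
Qed.

(** For fixed parities, the sum over shuffles is the coproduct restricted to first parts of length m
    + 1, by [sum_shuffle_unshuf]. *)
Lemma barwedge_lbarwedge n m (f : cochain A n) (g : cochain A m) b :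
  multilinear f -> lparity b (evalc g) ->
  barwedge f g = cochains_of (lbarwedge b (evalc f) (evalc g)) (n + m).
Proof.
move=> hf hg; have mf := evalc_lmultilin hf.
apply: funext => v; apply: eq_bigr => par _ /=.
(* For other lengths [evalc g] is 0, and so is [evalc f] with a zero entry. *)
rewrite /lbarwedge (eq_unshuf (K' := fun x y => if size x == m.+1 then
  evalc f (mktag (b (+) seq_par x) (evalc g x) :: y) else 0)); last first.
  by move=> x y _ _; case: ifP => // /negbT h; rewrite (evalc_size _ h) (lmultilin0 [::]).
rewrite /tag_seq -sum_shuffle_unshuf; last by rewrite ltnS leq_addl.
apply: eq_bigr => s _; rewrite (@eq_koszul_sign _ _ _ par) //; congr (_ *: _).
set h := fun i => mktag (par i) (v i); set W := ord_seq (h \o s).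
have W_nth (k : nat) : (k < (n + m).+1)%N ->
  tval (nth t0 W k) = hcomp (par (s (inord k))) (v (s (inord k))).
  by move=> hk; rewrite -{1}(inordK hk) nth_ord_seq.
have sW : size W = (n + m).+1 by rewrite size_ord_seq.
have stake : size (take m.+1 W) = m.+1 by rewrite size_takel // sW ltnS leq_addl.
rewrite [RHS]/evalc /= size_drop sW subSS addnK eqxx; congr f.
apply/ffunP => i; rewrite !ffunE; case: (unliftP ord0 i) => [i'|] -> /=.
  rewrite nth_drop W_nth; last by rewrite add0n addSn ltnS addnC ltn_add2r; exact: ltn_ord.
  (* Argument i' + 1 of [f] is entry m + (i' + 1) of the shuffled list, the inserted value being
     argument 0. *)
  have -> : (m.+1 + (0 + i') = m + bump 0 i')%N by rewrite /bump add0n addnA addn1.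
  by [].
rewrite tval_mktag hg /evalc stake eqxx; congr g; apply/ffunP => j.
rewrite !ffunE nth_take ?ltn_ord // W_nth //.
by have := ltn_ord j; lia.
Qed.

Lemma nr_bracketE n m (f : cochain A n) (g : cochain A m) :
  multilinear f -> multilinear g ->
  nr_bracket f g = cochains_of (lbracket (evalc f) (evalc g)) (n + m).
Proof.
move=> hf hg; apply: funext => v; rewrite /nr_bracket fct_sumE.
rewrite /cochains_of /lbracket exchange_big /=; apply: eq_bigr => a _.
rewrite fct_sumE exchange_big /=; apply: eq_bigr => b _.
have pm k (c : bool) (h : cochain A k) : multilinear h -> multilinear (cochain_part c h).
  by move=> hh; rewrite evalc_part //; apply: cochains_of_multilinear; apply: lpart_lmultilin;
    exact: evalc_lmultilin.
rewrite (@barwedge_lbarwedge _ _ _ _ b) ?(@barwedge_lbarwedge _ _ _ _ a) //; try exact: pm;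
  rewrite ?evalc_cochain_part //; try exact: lpart_lparity.
rewrite cast_cochain_family.
transitivity (cochains_of (lbarwedge b (lpart a (evalc f)) (lpart b (evalc g))) (n + m) v
  - (-1) ^+ (a && b) *: cochains_of (lbarwedge a (lpart b (evalc g)) (lpart a (evalc f))) (n +
    m) v) => //.
by rewrite /cochains_of scaler_sumr -sumrB.
Qed.

End Bridge.

Arguments cochains_of {A} L n v.

(** * The product D(A) and its bracket through list functions *)

Section Product.
Variable A : superAlgType.
Local Notation T := (tagged_elt A).
Implicit Types (L : seq T -> A) (F G H : cochains A).

Lemma cast_cochain_id n (e : n = n) (f : cochain A n) : cast_cochain e f = f.
Proof.
apply: funext => v; congr f; apply/ffunP => i.
by rewrite ffunE cast_ord_id.
Qed.

Lemma in_degree_id n (f : cochain A n) : in_degree f n = f.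
Proof. by rewrite /in_degree; case: eqP => // e; rewrite cast_cochain_id. Qed.

Lemma in_degree_neq n k (f : cochain A n) : n != k -> in_degree f k = 0.
Proof. by rewrite /in_degree; case: eqP. Qed.

Lemma Dn0 n : Dn A n 0.
Proof.
split=> [i v k x y|s par v _]; first by rewrite [RHS]addr0 scaler0.
by rewrite scaler0.
Qed.

Lemma in_degree_DD n (f : cochain A n) : Dn A n f -> DD A (in_degree f).
Proof.
move=> hf k; have [<-|nk] := eqVneq n k; first by rewrite in_degree_id.
by rewrite in_degree_neq //; exact: Dn0.
Qed.

Lemma evalL_in_degree n (f : cochain A n) : evalL (in_degree f) = evalc f.
Proof.
apply: funext => -[|t l]; first by rewrite evalc_size.
rewrite (@evalLE _ _ (size l)) //; have [<-|nk] := eqVneq n (size l);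
  first by rewrite in_degree_id.
rewrite in_degree_neq // (evalc_size f) ?/evalc ?eqxx //.
by rewrite /= eqSS eq_sym.
Qed.

Lemma DD_lmultilin F : DD A F -> lmultilin (evalL F).
Proof. by move=> hF; apply: evalL_lmultilin => n; case: (hF n). Qed.
Lemma DD_lsupersym F : DD A F -> lsupersym (evalL F).
Proof. by move=> hF; apply: evalL_lsupersym => n; case: (hF n). Qed.
Lemma DD_cochains_of F : DD A F -> cochains_of (evalL F) = F.
Proof.
by move=> hF; apply: functional_extensionality_dep => n; apply: cochains_of_evalL; case: (hF n).
Qed.
Lemma cochains_of_DD L : lmultilin L -> lsupersym L -> DD A (cochains_of L).
Proof. by move=> hM hS n; exact: cochains_of_Dn. Qed.

(** Identities in D(A) are proved by comparing list functions. *)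
Lemma evalL_inj F G : DD A F -> DD A G -> evalL F = evalL G -> F = G.
Proof. by move=> hF hG e; rewrite -(DD_cochains_of hF) -(DD_cochains_of hG) e. Qed.

(** The length of the inner sublist determines the index [i], so each splitting selects exactly one
    term of the sum. *)
Lemma lbarwedge_sum b (X Y : nat -> seq T -> A) X' Y' k l :
  (forall i, lmultilin (X i)) -> lmultilin X' -> Y' [::] = 0 -> size l = k.+1 ->
  (forall i l, X i l = if size l == i.+1 then X' l else 0) ->
  (forall i l, Y i l = if size l == i.+1 then Y' l else 0) ->
  \sum_(i < k.+1) lbarwedge b (X i) (Y (k - i)%N) l = lbarwedge b X' Y' l.
Proof.
move=> mX mX' Y0 sl XE YE; rewrite /lbarwedge -unshuf_sum; apply: eq_unshuf => x y.
rewrite sl; case: x => [|t x] sz _.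
  by rewrite Y0 (lmultilin0 [::]) // big1 // => i _; rewrite YE (lmultilin0 [::]).
have lt : (k - size x < k.+1)%N by lia.
have sx : (size x <= k)%N by move: sz => /=; lia.
rewrite (bigD1 (Ordinal lt)) //= big1 ?addr0 => [|i ni].
  rewrite subKn // YE eqxx XE (_ : size _ == _) //=.
  by move: sz => /=; lia.
rewrite YE; case: eqP => [e|_]; last by rewrite (lmultilin0 [::]).
exfalso; move: ni; rewrite -val_eqE /=; move: e => /= e.
by have := ltn_ord i; lia.
Qed.

Lemma lpart_evalc a F i l : lpart a (evalc (F i)) l =
  if size l == i.+1 then lpart a (evalL F) l else 0.
Proof.
case: eqP => [sl|/eqP nl]; first by rewrite /lpart (@evalLE _ _ i).
by rewrite /lpart evalc_size // linear0.
Qed.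

Lemma bracketE F G : DD A F -> DD A G -> bracket F G = cochains_of (lbracket (evalL F) (evalL G)).
Proof.
move=> hF hG; apply: functional_extensionality_dep => k; apply: funext => v.
rewrite /bracket fct_sumE.
under eq_bigr => i _.
  rewrite nr_bracketE; [|by case: (hF i)|by case: (hG (k - i)%N)].
  rewrite cast_cochain_family; over.
rewrite /cochains_of exchange_big /=; apply: eq_bigr => par _.
have sl : size (tag_seq par v) = k.+1 by rewrite size_ord_seq.
move: (tag_seq par v) sl => l sl.
have mF i : lmultilin (evalc (F i)) by apply: evalc_lmultilin; case: (hF i).
have mG i : lmultilin (evalc (G i)) by apply: evalc_lmultilin; case: (hG i).
rewrite /lbracket exchange_big /=; apply: eq_bigr => a _.
rewrite exchange_big /=; apply: eq_bigr => b _.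
rewrite big_split /= sumrN -scaler_sumr.
congr (_ - _ *: _).
  apply: (@lbarwedge_sum b (fun i => lpart a (evalc (F i))) (fun i =>
    lpart b (evalc (G i)))) => //.
  - by move=> i; exact: lpart_lmultilin.
  - by apply: lpart_lmultilin; exact: DD_lmultilin.
  - by rewrite /lpart linear0.
  - by move=> *; rewrite lpart_evalc.
  - by move=> *; rewrite lpart_evalc.
(* In the second product [G] is outermost, with index k - i; reversing the sum restores the form of
   [lbarwedge_sum]. *)
rewrite (reindex_inj rev_ord_inj) /=.
rewrite -(@lbarwedge_sum a (fun i => lpart b (evalc (G i))) (fun i =>
  lpart a (evalc (F i))) _ _ k) //.
- apply: eq_bigr => i _; rewrite subSS subKn //.
  by rewrite -ltnS.
- by move=> i; exact: lpart_lmultilin.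
- by apply: lpart_lmultilin; exact: DD_lmultilin.
- by rewrite /lpart linear0.
- by move=> *; rewrite lpart_evalc.
- by move=> *; rewrite lpart_evalc.
Qed.

Lemma evalL_bracket F G : DD A F -> DD A G -> evalL (bracket F G) = lbracket (evalL F) (evalL G).
Proof.
move=> hF hG; rewrite bracketE // evalL_cochains_of //; first by apply: lbracket_lmultilin;
  exact: DD_lmultilin.
by apply: lbracket_nil => //; exact: DD_lmultilin.
Qed.

Lemma bracket_DD F G : DD A F -> DD A G -> DD A (bracket F G).
Proof.
move=> hF hG; rewrite bracketE //.
by apply: cochains_of_DD; [apply: lbracket_lmultilin | apply: lbracket_lsupersym];
  (exact: DD_lmultilin || exact: DD_lsupersym).
Qed.

Lemma mu_cochains_of n : mu A n = cochains_of (@lmu A n) n.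
Proof.
apply: funext => v; rewrite /mu /cochains_of /lmu -scaler_sumr; congr (_ *: _).
apply: eq_bigr => par _; rewrite -sum_perm_conv_pow; apply: eq_bigr => s _.
rewrite (@eq_koszul_sign _ _ _ par) //; congr (_ *: _).
rewrite /sprod ord_seqS /prodl !ffunE /=; congr (foldl _ _ _).
rewrite /ord_seq -map_comp; apply: eq_map => i /=.
by rewrite !ffunE.
Qed.

Lemma mu_Dn n : Dn A n (mu A n).
Proof. by rewrite mu_cochains_of; apply: cochains_of_Dn;
  [exact: lmu_lmultilin | exact: lmu_lsupersym]. Qed.

Lemma evalc_mu n : evalc (mu A n) = @lmu A n.
Proof.
apply: funext => l; have [sl|nl] := eqVneq (size l) n.+1; last by rewrite evalc_size // lmu_size.
by rewrite mu_cochains_of evalc_cochains_of //; exact: lmu_lmultilin.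
Qed.

Lemma nr_bracket_mu n m :
  nr_bracket (mu A n) (mu A m) =
  ((n%:R - m%:R) * ((n + m + 1)`!)%:R / (((n + 1)`!)%:R * ((m + 1)`!)%:R)) *: mu A (n + m).
Proof.
have [hn _] := mu_Dn n; have [hm _] := mu_Dn m.
rewrite nr_bracketE // !evalc_mu mu_cochains_of; apply: funext => v.
transitivity (((n%:R - m%:R) * ((n + m + 1)`!)%:R / (((n + 1)`!)%:R * ((m + 1)`!)%:R)) *:
  cochains_of (@lmu A (n + m)) (n + m) v) => //.
by rewrite /cochains_of scaler_sumr; apply: eq_bigr => par _; exact: lbracket_lmu.
Qed.

Lemma mu_DD n : DD A (in_degree (mu A n)).
Proof. by apply: in_degree_DD; exact: mu_Dn. Qed.

Lemma evalL_rho n F : DD A F -> evalL (rho n F) = lbracket (@lmu A n) (evalL F).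
Proof. by move=> hF; rewrite /rho evalL_bracket ?evalL_in_degree ?evalc_mu //; exact: mu_DD. Qed.

Lemma rho_DD n F : DD A F -> DD A (rho n F).
Proof. by move=> hF; apply: bracket_DD => //; exact: mu_DD. Qed.

Lemma DD_lin a F G : DD A F -> DD A G -> DD A (a *: F + G).
Proof.
move=> hF hG n; case: (hF n) => mF sF; case: (hG n) => mG sG; split.
  move=> i v k x y.
  have E w : (a *: F + G) n w = a *: F n w + G n w by [].
  rewrite !E mF mG !scalerDr !scalerA (mulrC k) -!addrA; congr (_ + _).
  by rewrite addrCA.
move=> s par v hv.
have E w : (a *: F + G) n w = a *: F n w + G n w by [].
by rewrite !E (sF _ _ _ hv) (sG _ _ _ hv) scalerDr !scalerA mulrC.
Qed.

Lemma DD_0 : DD A 0.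
Proof. by move=> n; exact: Dn0. Qed.
Lemma DD_add F G : DD A F -> DD A G -> DD A (F + G).
Proof. by move=> hF hG; rewrite -[F]scale1r; exact: DD_lin. Qed.
Lemma DD_scale a F : DD A F -> DD A (a *: F).
Proof. by move=> hF; rewrite -[a *: F]addr0; apply: DD_lin => //; exact: DD_0. Qed.
Lemma DD_sum (I : Type) (r : seq I) (X : I -> cochains A) :
  (forall i, DD A (X i)) -> DD A (\sum_(i <- r) X i).
Proof. by move=> hX; elim/big_rec: _ => [|i F _]; [exact: DD_0 | exact: DD_add]. Qed.

Lemma evalL_lin a F G : evalL (a *: F + G) = fun l => a *: evalL F l + evalL G l.
Proof.
apply: funext => l; case: l => [|t l]; first by rewrite /= scaler0 addr0.
by rewrite !(@evalLE _ _ (size l)) // /evalc eqxx.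
Qed.

Lemma bracket_linl a F F' G : DD A F -> DD A F' -> DD A G ->
  bracket (a *: F + F') G = a *: bracket F G + bracket F' G.
Proof.
move=> hF hF' hG; apply: evalL_inj.
- by apply: bracket_DD => //; exact: DD_lin.
- by apply: DD_lin; exact: bracket_DD.
rewrite evalL_lin !evalL_bracket //; last exact: DD_lin.
by apply: funext => l; rewrite evalL_lin lbracket_linl //; exact: DD_lmultilin.
Qed.

Lemma bracket_linr a F G G' : DD A F -> DD A G -> DD A G' ->
  bracket F (a *: G + G') = a *: bracket F G + bracket F G'.
Proof.
move=> hF hF' hG; apply: evalL_inj.
- by apply: bracket_DD => //; exact: DD_lin.
- by apply: DD_lin; exact: bracket_DD.
rewrite evalL_lin !evalL_bracket //; last exact: DD_lin.
by apply: funext => l; rewrite evalL_lin lbracket_linr //; exact: DD_lmultilin.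
Qed.

Lemma rho_lin n a F G : DD A F -> DD A G -> rho n (a *: F + G) = a *: rho n F + rho n G.
Proof. by move=> hF hG; apply: bracket_linr => //; exact: mu_DD. Qed.

(** The Jacobi identity with the even element [mu A n] in first place. *)
Lemma rho_bracket n F G : DD A F -> DD A G ->
  rho n (bracket F G) = bracket (rho n F) G + bracket F (rho n G).
Proof.
move=> hF hG; have hFG := bracket_DD hF hG; have hr := @rho_DD n.
rewrite -[X in _ = X + _]scale1r; apply: evalL_inj.
- exact: hr.
- by apply: DD_lin; apply: bracket_DD => //; exact: hr.
rewrite evalL_rho // evalL_lin (evalL_bracket (hr _ hF) hG) (evalL_bracket hF (hr _ hG))
  (evalL_bracket hF hG).
rewrite !evalL_rho // lbracket_jacobi;
  try (exact: lmu_lmultilin || exact: lmu_lsupersym || exact: DD_lmultilin ||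
    exact: DD_lsupersym || exact: lmu_lparity).
by apply: funext => l; rewrite scale1r.
Qed.

End Product.

(** * Exponentials of derivations *)

Section DividedPowers.
Variable X : lmodType rat.
Implicit Types (D : X -> X) (P : X -> Prop).

Definition dpow D j x : X := (j`!)%:R^-1 *: iter j D x.

Lemma fact_neq0 j : (j`!)%:R != 0 :> rat.
Proof. by rewrite Num.Theory.pnatr_eq0 -lt0n fact_gt0. Qed.

Lemma dpow_shift D j x : dpow D j (D x) = j.+1%:R *: dpow D j.+1 x.
Proof.
rewrite /dpow scalerA -iterSr; congr (_ *: _).
have h : j.+1%:R != 0 :> rat by rewrite Num.Theory.pnatr_eq0.
by rewrite factS natrM invfM mulrA divff // mul1r.
Qed.

(** With divided powers the Leibniz rule has no binomial coefficients. Separate operators and the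
    predicate [P] allow its use both for the bracket on [DD A] and for vector fields acting on
    series. *)
Lemma leibniz P (b : X -> X -> X) D1 D2 D3 :
  (forall x, P x -> P (D1 x)) -> (forall x, P x -> P (D2 x)) -> (forall x, P x -> P (D3 x)) ->
  (forall c x, P x -> P (c *: x)) ->
  (forall x y, P x -> P y -> P (b x y)) ->
  (forall x y, P x -> P y -> D3 (x + y) = D3 x + D3 y) ->
  (forall c x y, P x -> P y -> b (c *: x) y = c *: b x y) ->
  (forall c x y, P x -> P y -> b x (c *: y) = c *: b x y) ->
  (forall x y, P x -> P y -> D3 (b x y) = b (D1 x) y + b x (D2 y)) ->
  forall j x y, P x -> P y ->
    dpow D3 j (b x y) = \sum_(i < j.+1) b (dpow D1 i x) (dpow D2 (j - i) y).
Proof.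
move=> P1 P2 P3 PZ Pb D3D bl br lei j.
have Pi D (PD : forall x, P x -> P (D x)) i x : P x -> P (iter i D x).
  by move=> hx; elim: i => //= i IH; exact: PD.
have Pd D (PD : forall x, P x -> P (D x)) i x : P x -> P (dpow D i x).
  by move=> hx; apply: PZ; exact: Pi.
have iterD i x y : P x -> P y -> iter i D3 (x + y) = iter i D3 x + iter i D3 y.
  by move=> hx hy; elim: i => //= i ->; rewrite D3D //; exact: Pi.
elim: j => [|j IH] x y hx hy.
  by rewrite big_ord1 /dpow /= fact0 invr1 !scale1r.
have jn0 : j.+1%:R != 0 :> rat by rewrite Num.Theory.pnatr_eq0.
(* After multiplication by j + 1 one derivation is applied first, and the induction hypothesis
   treats the other j. *)
apply: (scalerI jn0); rewrite -dpow_shift lei // /dpow iterD; try (apply: Pb => //;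
  (exact: P1 || exact: P2)).
have L1 : dpow D3 j (b (D1 x) y) =
    \sum_(i < j.+1) i.+1%:R *: b (dpow D1 i.+1 x) (dpow D2 (j - i) y).
  rewrite IH //; last exact: P1.
  by apply: eq_bigr => i _; rewrite dpow_shift bl //; exact: Pd.
have L2 : dpow D3 j (b x (D2 y)) =
    \sum_(i < j.+1) (j.+1 - i)%:R *: b (dpow D1 i x) (dpow D2 (j.+1 - i) y).
  rewrite IH //; last exact: P2.
  apply: eq_bigr => i _; rewrite dpow_shift br; try exact: Pd.
  by rewrite subSn // -ltnS.
rewrite scalerDr -/(dpow D3 j (b (D1 x) y)) -/(dpow D3 j (b x (D2 y))) L1 L2.
(* The weight j + 1 is split as i + (j + 1 - i), one summand for each of [L1] and [L2]. *)
rewrite scaler_sumr [RHS](eq_bigr (fun i : 'I_j.+2 =>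
  i%:R *: b (dpow D1 i x) (dpow D2 (j.+1 - i) y)
   + (j.+1 - i)%:R *: b (dpow D1 i x) (dpow D2 (j.+1 - i) y))); last first.
  by move=> i _; rewrite -scalerDl -natrD subnKC // -ltnS.
rewrite big_split /=; congr (_ + _).
  by rewrite [RHS]big_ord_recl /= scale0r add0r; apply: eq_bigr => i _.
by rewrite [RHS]big_ord_recr /= subnn scale0r addr0; apply: eq_bigr => i _.
Qed.

(** Terms of total degree at least [J] vanish, so summing by total degree agrees with summing over
    the square. *)
Lemma sum_triangle (V : zmodType) J (g : nat -> nat -> V) :
  (forall i j, (J <= i + j)%N -> g i j = 0) ->
  \sum_(j < J) \sum_(i < j.+1) g i (j - i)%N = \sum_(i < J) \sum_(j < J) g i j.
Proof.
move=> g0.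
transitivity (\sum_(j < J) \sum_(i < J | (i <= j)%N) g i (j - i)%N).
  apply: eq_bigr => j _.
  rewrite -(big_mkord (fun i => (i <= j)%N) (fun i => g i (j - i)%N)).
  rewrite -(big_mkord xpredT (fun i => g i (j - i)%N)).
  rewrite [RHS](@big_cat_nat _ _ _ j.+1) //= [X in _ + X]big_nat_cond [X in _ + X]big1 ?addr0.
    by rewrite big_nat_cond [RHS]big_nat_cond; apply: eq_bigl => i; lia.
  by move=> i h; exfalso; lia.
rewrite (exchange_big_dep xpredT) //=; apply: eq_bigr => i _.
rewrite -(big_mkord (fun j => (i <= j)%N) (fun j => g i (j - i)%N)).
rewrite -(big_mkord xpredT (fun j => g i j)) /=.
have iJ : (i <= J)%N by exact: ltnW.
rewrite (@big_cat_nat _ _ _ i) //= [X in X + _]big_nat_cond [X in X + _]big1 ?add0r;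
  last by move=> ? ?; exfalso; lia.
rewrite [RHS](@big_cat_nat _ _ _ (J - i)%N) ?leq_subr //= [X in _ + X]big_nat_cond [X in _ +
  X]big1 ?addr0; last first.
  by move=> j hj; apply: g0; lia.
rewrite -{1}[i : nat]add0n big_addn big_nat_cond [RHS]big_nat_cond.
by apply: eq_big => [j|j _]; [lia | rewrite addnK].
Qed.

(** The coefficients of exp(-t) exp(t) = 1, obtained from the binomial expansion of (1 - 1)^l. *)
Lemma sum_dpow_inv l : \sum_(i < l.+1) (-1) ^+ i / ((i`!)%:R *
  ((l - i)`!)%:R) = (l == 0%N)%:R :> rat.
Proof.
have E (i : 'I_l.+1) : (-1) ^+ i / ((i`!)%:R * ((l - i)`!)%:R) =
    (l`!)%:R^-1 * (1 ^+ (l - i) * (-1) ^+ i *+ 'C(l, i)) :> rat.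
  have il : (i <= l)%N by rewrite -ltnS.
  have := bin_fact il => /(congr1 (fun n => n%:R : rat)); rewrite !natrM => <-.
  have h1 := fact_neq0 i; have h2 := fact_neq0 (l - i).
  have h3 : ('C(l, i))%:R != 0 :> rat by rewrite Num.Theory.pnatr_eq0 -lt0n bin_gt0.
  rewrite expr1n mul1r -mulr_natr; field.
  by rewrite h1 h2 h3.
rewrite (eq_bigr _ (fun i _ => E i)) -mulr_sumr -exprDn subrr.
by case: l {E} => [|l]; rewrite ?fact0 ?expr0 ?invr1 ?mulr1 // expr0n mulr0.
Qed.

End DividedPowers.

(** * The filtration by index and the exponential of the Koszul operator *)

Section Exponential.
Variable A : superAlgType.
Implicit Types (F G H : cochains A).

Definition vanish_below s F := forall j, (j < s)%N -> F j = 0.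

Lemma evalc0 n : evalc (0 : cochain A n) = fun=> 0.
Proof. by apply: funext => l; rewrite /evalc; case: ifP. Qed.

Lemma lpart0 b : lpart b (fun=> 0 : A) = fun=> 0.
Proof. by apply: funext => l; rewrite /lpart linear0. Qed.

Lemma lbracket_0l (L : seq (tagged_elt A) -> A) l : lmultilin L -> lbracket (fun=> 0) L l = 0.
Proof.
move=> hL; apply: big1 => a _; apply: big1 => b _.
by rewrite lpart0 lbarwedge_0l lbarwedge_0r ?scaler0 ?subr0 //; exact: lpart_lmultilin.
Qed.

Lemma lbracket_0r (L : seq (tagged_elt A) -> A) l : lmultilin L -> lbracket L (fun=> 0) l = 0.
Proof.
move=> hL; apply: big1 => a _; apply: big1 => b _.
by rewrite lpart0 lbarwedge_0l lbarwedge_0r ?scaler0 ?subr0 //; exact: lpart_lmultilin.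
Qed.

Lemma nr_bracket0l n m (g : cochain A m) : multilinear g -> nr_bracket (0 : cochain A n) g = 0.
Proof.
move=> hg; have [h0 _] := @Dn0 A n; rewrite nr_bracketE // evalc0; apply: funext => v.
by apply: big1 => par _; rewrite lbracket_0l //; exact: evalc_lmultilin.
Qed.

Lemma nr_bracket0r n m (f : cochain A n) : multilinear f -> nr_bracket f (0 : cochain A m) = 0.
Proof.
move=> hg; have [h0 _] := @Dn0 A m; rewrite nr_bracketE // evalc0; apply: funext => v.
by apply: big1 => par _; rewrite lbracket_0r //; exact: evalc_lmultilin.
Qed.

Lemma cast_cochain0 n m (e : n = m) : cast_cochain e (0 : cochain A n) = 0.
Proof. by case: _ / e; rewrite cast_cochain_id. Qed.

(** Lets infinite sums be truncated when a single component is computed. *)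
Lemma bracket_local F F' G G' k :
  (forall i, (i <= k)%N -> F i = F' i) -> (forall i, (i <= k)%N -> G i = G' i) ->
  bracket F G k = bracket F' G' k.
Proof.
move=> hF hG; apply: eq_bigr => i _; rewrite hF ?hG ?leq_subr //.
by rewrite -ltnS.
Qed.

Lemma bracket_vanish s t F G : DD A F -> DD A G -> vanish_below s F -> vanish_below t G ->
  vanish_below (s + t) (bracket F G).
Proof.
move=> hF hG sF tG k kst; rewrite /bracket; apply: big1 => i _.
have [mF _] := hF i; have [mG _] := hG (k - i)%N.
have [lt|ge] := ltnP i s; first by rewrite sF // nr_bracket0l // cast_cochain0.
have lt : (k - i < t)%N by have := ltn_ord i; lia.
by rewrite tG // nr_bracket0r // cast_cochain0.
Qed.

Lemma in_degree_vanish n (f : cochain A n) : vanish_below n (in_degree f).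
Proof. by move=> j jn; rewrite in_degree_neq // gtn_eqF. Qed.

Lemma rho_vanish n s F : DD A F -> vanish_below s F -> vanish_below (n + s) (rho n F).
Proof.
move=> hF sF; apply: bracket_vanish => //; first exact: mu_DD.
exact: in_degree_vanish.
Qed.

Variable K : nat -> rat.

(** A finite combination of the [rho n] as operators on D(A), equal to [koszul_op] in the components
    up to [N]; linearity and the derivation property pass from it to [koszul_op]. *)
Definition koszul_op_upto N F : cochains A := - \sum_(1 <= n < N.+1) K n *: rho n F.
Arguments koszul_op_upto : clear implicits.

Lemma cochains_sumE (I : Type) (r : seq I) (P : pred I) (X : I -> cochains A) k :
  (\sum_(i <- r | P i) X i) k = \sum_(i <- r | P i) X i k.
Proof. by elim/big_rec2: _ => // i x y _ <-. Qed.

Lemma koszul_op_upto_sum N F :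
  koszul_op_upto N F = \sum_(1 <= n < N.+1) (- K n) *: rho n F.
Proof. by rewrite /koszul_op_upto -sumrN; apply: eq_bigr => n _; rewrite scaleNr. Qed.

Lemma koszul_op_uptoE N F k : DD A F -> (k <= N)%N ->
  koszul_op_upto N F k = koszul_op K F k.
Proof.
move=> hF kN.
have -> : koszul_op_upto N F k = - \sum_(1 <= n < N.+1) K n *: rho n F k.
  by rewrite -[LHS]/(- ((\sum_(1 <= n < N.+1) K n *: rho n F) k)) cochains_sumE.
rewrite /koszul_op (@big_cat_nat _ _ _ k.+1) //= [X in _ + X]big_nat_cond [X in _ + X]big1
  ?addr0 //.
move=> n /andP[/andP[kn _] _]; rewrite (@rho_vanish n 0) ?scaler0 //.
by rewrite addn0.
Qed.

Lemma koszul_op_upto_DD N F : DD A F -> DD A (koszul_op_upto N F).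
Proof.
move=> hF; rewrite /koszul_op_upto -scaleN1r; apply: DD_scale.
by apply: DD_sum => n; apply: DD_scale; exact: rho_DD.
Qed.

Lemma koszul_op_DD F : DD A F -> DD A (koszul_op K F).
Proof. by move=> hF k; rewrite -(@koszul_op_uptoE k) //; exact: koszul_op_upto_DD. Qed.

Lemma koszul_op_lin a F G : DD A F -> DD A G ->
  koszul_op K (a *: F + G) = a *: koszul_op K F + koszul_op K G.
Proof.
move=> hF hG; apply: functional_extensionality_dep => k.
rewrite -(@koszul_op_uptoE k) //; last exact: DD_lin.
rewrite -[RHS]/(a *: koszul_op K F k + koszul_op K G k) -!(@koszul_op_uptoE k) //.
rewrite -[RHS]/((a *: koszul_op_upto k F + koszul_op_upto k G) k).
congr (_ k); rewrite !koszul_op_upto_sum scaler_sumr -big_split.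
by apply: eq_bigr => n _ /=; rewrite rho_lin // scalerDr !scalerA mulrC.
Qed.

Lemma koszul_op_vanish s F : DD A F -> vanish_below s F -> vanish_below s.+1 (koszul_op K F).
Proof.
move=> hF sF k ks; rewrite /koszul_op big_nat_cond big1 ?oppr0 // => n /andP[/andP[n0 _] _].
rewrite (@rho_vanish n s) ?scaler0 //; lia.
Qed.

Lemma bracket0l G : DD A G -> bracket 0 G = 0.
Proof.
move=> hG; have := bracket_linl (-1) (@DD_0 A) (@DD_0 A) hG.
by rewrite !scaleN1r oppr0 addr0 addNr.
Qed.

Lemma bracket0r G : DD A G -> bracket G 0 = 0.
Proof.
move=> hG; have := bracket_linr (-1) hG (@DD_0 A) (@DD_0 A).
by rewrite !scaleN1r oppr0 addr0 addNr.
Qed.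

Lemma bracketZl a F G : DD A F -> DD A G -> bracket (a *: F) G = a *: bracket F G.
Proof.
by move=> hF hG; rewrite -[a *: F]addr0 bracket_linl ?bracket0l ?addr0 //; exact: DD_0.
Qed.

Lemma bracketZr a F G : DD A F -> DD A G -> bracket G (a *: F) = a *: bracket G F.
Proof.
by move=> hF hG; rewrite -[a *: F]addr0 bracket_linr ?bracket0r ?addr0 //; exact: DD_0.
Qed.

Lemma bracket_suml (I : Type) (r : seq I) (X : I -> cochains A) G :
  (forall i, DD A (X i)) -> DD A G ->
  bracket (\sum_(i <- r) X i) G = \sum_(i <- r) bracket (X i) G.
Proof.
move=> hX hG; elim: r => [|i r IH]; first by rewrite !big_nil bracket0l.
rewrite !big_cons -[X i]scale1r bracket_linl // ?IH ?scale1r //.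
exact: DD_sum.
Qed.

Lemma bracket_sumr (I : Type) (r : seq I) (X : I -> cochains A) G :
  (forall i, DD A (X i)) -> DD A G ->
  bracket G (\sum_(i <- r) X i) = \sum_(i <- r) bracket G (X i).
Proof.
move=> hX hG; elim: r => [|i r IH]; first by rewrite !big_nil bracket0r.
rewrite !big_cons -[X i]scale1r bracket_linr // ?IH ?scale1r //.
exact: DD_sum.
Qed.

(** In component [k] the operator may be truncated at [k], where it is a finite combination of the
    derivations [rho n]. *)
Lemma koszul_op_bracket F G : DD A F -> DD A G ->
  koszul_op K (bracket F G) = bracket (koszul_op K F) G + bracket F (koszul_op K G).
Proof.
move=> hF hG; have hFG := bracket_DD hF hG.
apply: functional_extensionality_dep => k; rewrite -(@koszul_op_uptoE k) //.
rewrite -[RHS]/(bracket (koszul_op K F) G k + bracket F (koszul_op K G) k).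
rewrite (@bracket_local (koszul_op K F) (koszul_op_upto k F) G G); [|by move=> *;
  rewrite koszul_op_uptoE|by []].
rewrite (@bracket_local F F (koszul_op K G) (koszul_op_upto k G)); [|by []|by move=> *;
  rewrite koszul_op_uptoE].
rewrite -[RHS]/((bracket (koszul_op_upto k F) G + bracket F (koszul_op_upto k G)) k).
congr (_ k).
have rD n H : DD A H -> DD A (- K n *: rho n H) by move=> hH; apply: DD_scale; exact: rho_DD.
rewrite !koszul_op_upto_sum bracket_suml ?bracket_sumr //; try (by move=> n; exact: rD).
rewrite -big_split; apply: eq_bigr => n _ /=.
by rewrite rho_bracket // scalerDr bracketZl ?bracketZr //; exact: rho_DD.
Qed.

Lemma iter_koszul_DD j F : DD A F -> DD A (iter j (koszul_op K) F).
Proof. by move=> hF; elim: j => //= j IH; exact: koszul_op_DD. Qed.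

Lemma iter_koszul_vanish j s F : DD A F -> vanish_below s F ->
  vanish_below (j + s) (iter j (koszul_op K) F).
Proof.
move=> hF sF; elim: j => //= j IH; rewrite addSn; apply: koszul_op_vanish => //.
exact: iter_koszul_DD.
Qed.

Lemma iter_koszul_lin j a F G : DD A F -> DD A G ->
  iter j (koszul_op K) (a *: F + G) = a *: iter j (koszul_op K) F + iter j (koszul_op K) G.
Proof.
by move=> hF hG; elim: j => //= j ->; rewrite koszul_op_lin //; exact: iter_koszul_DD.
Qed.

(** The truncated exponential, equal to the exponential in the components below [J]. *)
Definition exp_upto J F : cochains A := \sum_(j < J) (j`!)%:R^-1 *: iter j (koszul_op K) F.
Arguments exp_upto : clear implicits.

Lemma exp_uptoE J F k : DD A F -> (k < J)%N -> exp_upto J F k = exp_koszul_op K F k.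
Proof.
move=> hF kJ; rewrite /exp_upto cochains_sumE /exp_koszul_op.
rewrite -(big_mkord xpredT (fun j => (j`!)%:R^-1 *: iter j (koszul_op K) F k)).
rewrite -[RHS](big_mkord xpredT (fun j => (j`!)%:R^-1 *: iter j (koszul_op K) F k)).
rewrite (@big_cat_nat _ _ _ k.+1) //= [X in _ + X]big_nat_cond [X in _ + X]big1 ?addr0 //.
move=> j /andP[/andP[kj _] _]; rewrite (@iter_koszul_vanish j 0) ?scaler0 //.
by rewrite addn0.
Qed.

Lemma exp_upto_DD J F : DD A F -> DD A (exp_upto J F).
Proof. by move=> hF; apply: DD_sum => j; apply: DD_scale; exact: iter_koszul_DD. Qed.

Lemma exp_DD F : DD A F -> DD A (exp_koszul_op K F).
Proof. by move=> hF k; rewrite -(@exp_uptoE k.+1) //; exact: exp_upto_DD. Qed.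

Lemma exp_lin a F G : DD A F -> DD A G ->
  exp_koszul_op K (a *: F + G) = a *: exp_koszul_op K F + exp_koszul_op K G.
Proof.
move=> hF hG; apply: functional_extensionality_dep => k.
rewrite -[RHS]/(a *: exp_koszul_op K F k + exp_koszul_op K G k) /exp_koszul_op.
rewrite scaler_sumr -big_split; apply: eq_bigr => j _ /=.
rewrite iter_koszul_lin // scalerA mulrC -scalerA -scalerDr.
by [].
Qed.

(** The exponential of a derivation is an automorphism: the Leibniz rule for divided powers, summed
    over the triangle of pairs of powers. *)
Lemma exp_bracket F G : DD A F -> DD A G ->
  exp_koszul_op K (bracket F G) = bracket (exp_koszul_op K F) (exp_koszul_op K G).
Proof.
move=> hF hG; have hFG := bracket_DD hF hG.
apply: functional_extensionality_dep => k.
rewrite (@bracket_local _ (exp_upto k.+1 F) _ (exp_upto k.+1 G)); last 2 first.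
- by move=> i ik; rewrite exp_uptoE.
- by move=> i ik; rewrite exp_uptoE.
have Dd i H : DD A H -> DD A (dpow (koszul_op K) i H).
  by move=> hH; apply: DD_scale; exact: iter_koszul_DD.
have dv i H : DD A H -> vanish_below i (dpow (koszul_op K) i H).
  move=> hH a ai; rewrite /dpow -[LHS]/(_ *: iter i _ H a).
  by rewrite (@iter_koszul_vanish i 0) ?scaler0 // addn0.
rewrite -(@exp_uptoE k.+1) // /exp_upto.
rewrite bracket_suml; [|by move=> j; exact: Dd|exact: exp_upto_DD].
(* Each power raises the index by at least one, so [g i j] vanishes when i + j > k. *)
pose g i j := bracket (dpow (koszul_op K) i F) (dpow (koszul_op K) j G) k.
transitivity (\sum_(i < k.+1) \sum_(j < k.+1) g i j); last first.
  rewrite cochains_sumE; apply: eq_bigr => i _.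
  rewrite bracket_sumr; [|by move=> j; exact: Dd|exact: Dd].
  by rewrite cochains_sumE.
rewrite -sum_triangle; last first.
  by move=> i j kij; apply: (@bracket_vanish i j) => //; (exact: Dd || exact: dv).
rewrite cochains_sumE; apply: eq_bigr => j _.
transitivity (dpow (koszul_op K) j (bracket F G) k); first by [].
rewrite (@leibniz _ (DD A) _ (koszul_op K) (koszul_op K)) ?cochains_sumE //.
- exact: koszul_op_DD.
- exact: koszul_op_DD.
- exact: koszul_op_DD.
- exact: DD_scale.
- exact: bracket_DD.
- by move=> x y hx hy; rewrite -[x]scale1r koszul_op_lin // !scale1r.
- by move=> *; rewrite bracketZl.
- by move=> *; rewrite bracketZr.
- exact: koszul_op_bracket.
Qed.

Lemma parity_lin b a F G : cochains_parity b F -> cochains_parity b G ->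
  cochains_parity b (a *: F + G).
Proof.
move=> hF hG n par v hv; have E : (a *: F + G) n v = a *: F n v + G n v by [].
by rewrite /homog E linearP; congr (_ *: _ + _); [exact: hF | exact: hG].
Qed.

Lemma parity0 b : cochains_parity b (0 : cochains A).
Proof. by move=> n par v hv; rewrite /homog linear0. Qed.

Lemma parity_sum b (I : Type) (r : seq I) (c : I -> rat) (X : I -> cochains A) :
  (forall i, cochains_parity b (X i)) -> cochains_parity b (\sum_(i <- r) c i *: X i).
Proof.
by move=> hX; elim/big_rec: _ => [|i F _]; [exact: parity0 | exact: parity_lin].
Qed.

Lemma parity_lparity b F : DD A F -> cochains_parity b F <-> lparity b (evalL F).
Proof.
move=> hF; split=> h.
  case=> [|t l]; first by rewrite linear0.
  rewrite (@evalLE _ _ (size l)) // /evalc eqxx.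
  have -> : seq_par (t :: l) = par_sum [ffun i : 'I_(size l).+1 =>
    tpar (nth (mktag false 0) (t :: l) i)].
    rewrite -[in LHS](ord_seq_nth (erefl (size (t :: l)))) seq_par_ord_seq.
    by apply: eq_bigr => i _; rewrite ffunE.
  by apply: h => i; rewrite !ffunE; exact: tval_hcomp.
move=> n par v hv; rewrite /homog -(seq_par_tag_seq par v).
have <- : evalL F (tag_seq par v) = F n v; last exact: h.
by rewrite evalL_tag_seq; congr (F n); apply/ffunP => i; rewrite ffunE hv.
Qed.

Lemma rho_parity n b F : DD A F -> cochains_parity b F -> cochains_parity b (rho n F).
Proof.
move=> hF /(parity_lparity b hF) h; apply/(parity_lparity b (rho_DD n hF)).
rewrite evalL_rho //; apply: (@lbracket_lparity _ false b);
  [exact: lmu_lmultilin | exact: DD_lmultilin | exact: lmu_lparity | exact: h].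
Qed.

Lemma koszul_op_parity b F : DD A F -> cochains_parity b F -> cochains_parity b (koszul_op K F).
Proof.
move=> hF h k; rewrite -(@koszul_op_uptoE k) //.
by rewrite koszul_op_upto_sum; apply: parity_sum => n; exact: rho_parity.
Qed.

Lemma exp_parity b F : DD A F -> cochains_parity b F -> cochains_parity b (exp_koszul_op K F).
Proof.
move=> hF h k; rewrite -(@exp_uptoE k.+1) //; apply: parity_sum => j.
elim: {j}(j : nat) => //= j IH; apply: koszul_op_parity => //.
exact: iter_koszul_DD.
Qed.

End Exponential.

Arguments exp_upto {A} K J F n v.

(** * The inverse of the exponential *)

Section Inverse.
Variable A : superAlgType.
Implicit Types (F G H : cochains A) (K : nat -> rat).

Lemma koszul_op_opp K F : koszul_op (fun n => - K n) F = - koszul_op K F.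
Proof.
apply: functional_extensionality_dep => k.
rewrite -[RHS]/(- koszul_op K F k) /koszul_op; congr (- _).
by rewrite -sumrN; apply: eq_bigr => n _; rewrite scaleNr.
Qed.

Lemma iter_koszul_opp K j F : DD A F ->
  iter j (koszul_op (fun n => - K n)) F = (-1) ^+ j *: iter j (koszul_op K) F.
Proof.
move=> hF; elim: j => [|j IH]; first by rewrite scale1r.
rewrite !iterS IH koszul_op_opp -[(-1) ^+ j *: _]addr0 koszul_op_lin.
- have := koszul_op_lin K (-1) (@DD_0 A) (@DD_0 A).
  rewrite !scaleN1r oppr0 addr0 addNr => ->.
  by rewrite addr0 exprS mulN1r scaleNr.
- exact: iter_koszul_DD.
- exact: DD_0.
Qed.

Lemma exp_koszul_opK K F : DD A F ->
  exp_koszul_op K (exp_koszul_op (fun n => - K n) F) = F.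
Proof.
move=> hF; apply: functional_extensionality_dep => k.
set E := exp_koszul_op _ F; have hE : DD A E by exact: exp_DD.
have hU := exp_upto_DD (fun n => - K n) k.+1 hF.
(* The inner exponential may be truncated: the difference vanishes up to index [k], and iteration
   preserves this. *)
have loc j : iter j (koszul_op K) E k = iter j (koszul_op K) (exp_upto (fun n => - K n) k.+1 F) k.
  have : vanish_below k.+1 (-1 *: exp_upto (fun n => - K n) k.+1 F + E).
    move=> i ik; rewrite -[LHS]/(-1 *: exp_upto (fun n => - K n) k.+1 F i + E i).
    by rewrite exp_uptoE // scaleN1r addNr.
  move=> /(@iter_koszul_vanish _ K j _ _ (DD_lin (-1) hU hE)) /(_ k).
  rewrite addnS ltnS leq_addl iter_koszul_lin // => /(_ isT).
  rewrite -[LHS]/(-1 *: iter j (koszul_op K) (exp_upto (fun n => - K n) k.+1 F) k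
    + iter j (koszul_op K) E k) scaleN1r addrC => /eqP.
  by rewrite subr_eq0 => /eqP.
rewrite /exp_koszul_op; under eq_bigr => j _ do rewrite loc.
have iter_sum j : iter j (koszul_op K) (exp_upto (fun n => - K n) k.+1 F) =
    \sum_(i < k.+1) ((-1) ^+ i / (i`!)%:R) *: iter (j + i) (koszul_op K) F.
  rewrite /exp_upto; elim: (index_enum _) => [|i r IH].
    rewrite !big_nil; have := iter_koszul_lin K j (-1) (@DD_0 A) (@DD_0 A).
    by rewrite !scaleN1r oppr0 addr0 addNr.
  rewrite !big_cons iter_koszul_lin.
  - rewrite IH iter_koszul_opp // -[_ *: iter i _ F]addr0 iter_koszul_lin; last exact: DD_0.
      have := iter_koszul_lin K j (-1) (@DD_0 A) (@DD_0 A).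
      rewrite !scaleN1r oppr0 addr0 addNr => ->.
      by rewrite addr0 scalerA iterD mulrC.
    exact: iter_koszul_DD.
  - exact: iter_koszul_DD.
  - by apply: DD_sum => i'; apply: DD_scale; exact: iter_koszul_DD.
pose g i j : cochain A k :=
  ((-1) ^+ i / ((i`!)%:R * (j`!)%:R)) *: iter (i + j) (koszul_op K) F k.
transitivity (\sum_(j < k.+1) \sum_(i < k.+1) g i j).
  apply: eq_bigr => j _; rewrite iter_sum cochains_sumE scaler_sumr; apply: eq_bigr => i _.
  transitivity ((j`!)%:R^-1 *: (((-1) ^+ i / (i`!)%:R) *: iter (j + i) (koszul_op K) F k)) => //.
  by rewrite /g scalerA invfM addnC; congr (_ *: _); ring.
rewrite exchange_big /= -sum_triangle; last first.
  move=> i j kij; rewrite /g (@iter_koszul_vanish _ K _ 0) ?scaler0 //.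
  by rewrite addn0; lia.
(* Grouped by the total power [l], the coefficients are those of exp(-t) exp(t). *)
transitivity (\sum_(l < k.+1) ((l == 0%N :> nat)%:R : rat) *: iter l (koszul_op K) F k).
  apply: eq_bigr => l _; rewrite -sum_dpow_inv scaler_suml; apply: eq_bigr => i _.
  by rewrite /g subnKC // -ltnS.
rewrite big_ord_recl /= scale1r big1 ?addr0 // => i _.
by rewrite scale0r.
Qed.

(** The exponential for -K is a right inverse for every [K]; applied to -K as well, this makes it
    two-sided. *)
Lemma exp_koszul_bij K : set_bij (DD A) (DD A) (@exp_koszul_op A K).
Proof.
have KK : (fun n => - - K n) = K by apply: funext => n; rewrite opprK.
split.
- by move=> F hF; exact: exp_DD.
- move=> F G /set_mem hF /set_mem hG e.
  have := @exp_koszul_opK (fun n => - K n) F hF; rewrite KK e => <-.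
  by have := @exp_koszul_opK (fun n => - K n) G hG; rewrite KK.
- move=> G hG; exists (exp_koszul_op (fun n => - K n) G); first exact: exp_DD.
  exact: exp_koszul_opK.
Qed.

Lemma exp_koszul_iso K : lie_superalgebra_iso (@exp_koszul_op A K).
Proof.
split; [exact: exp_koszul_bij | | |].
- by move=> *; exact: exp_lin.
- by move=> *; exact: exp_parity.
- by move=> *; exact: exp_bracket.
Qed.
End Inverse.

(** * The power series computation *)

Section PowerSeries.
(** Values in [rat^o] make series a module over [rat], as [leibniz] requires. *)
Local Notation ser := (nat -> rat^o).
Implicit Types (p q x : ser).

(** Identities of series are inherited from polynomials that agree with them in low degrees. *)
Definition agree M p (P : {poly rat}) := forall i, (i < M)%N -> p i = P`_i.

Lemma agree_poly M p : agree M p (\poly_(i < M) p i).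
Proof. by move=> i iM; rewrite coef_poly iM. Qed.

Lemma agreeS M p P : agree M.+1 p P -> agree M p P.
Proof. by move=> h i iM; apply: h; exact: ltnW. Qed.

Lemma agree_mul M p P q Q : agree M p P -> agree M q Q -> agree M (fps_mul p q) (P * Q).
Proof.
move=> hp hq k kM; rewrite coefM; apply: eq_bigr => i _.
by have := ltn_ord i => h; rewrite hp ?hq //; lia.
Qed.

Lemma agree_deriv M p P : agree M.+1 p P -> agree M (fps_deriv p) P^`().
Proof. by move=> hp k kM; rewrite coef_deriv /fps_deriv hp // mulr_natl. Qed.

Definition ser_vanish s p := forall i, (i < s)%N -> p i = 0.

Lemma fps_mul_vanish s t p q : ser_vanish s p -> ser_vanish t q ->
  ser_vanish (s + t) (fps_mul p q).
Proof.
move=> hp hq k kst; apply: big1 => i _.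
have [lt|ge] := ltnP i s; first by rewrite hp // mul0r.
by rewrite hq ?mulr0 //; have := ltn_ord i; lia.
Qed.

Lemma fps_deriv_vanish s p : ser_vanish s.+1 p -> ser_vanish s (fps_deriv p).
Proof. by move=> hp k ks; rewrite /fps_deriv hp ?mulr0. Qed.

Variable K : nat -> rat.

(* The adjoint action [X d/dt, p d/dt] = (X p' - X' p) d/dt on vector fields. *)
Definition koszul_ad p : ser := fun k =>
  koszul_field K p k - fps_mul (fps_deriv (koszul_series K)) p k.

Definition field_apply p x : ser := fps_mul p (fps_deriv x).

Lemma koszul_series_vanish : ser_vanish 2 (koszul_series K).
Proof. by move=> [|[|i]]. Qed.

Lemma koszul_field_vanish s p : ser_vanish s.+1 p -> ser_vanish s.+2 (koszul_field K p).
Proof.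
move=> hp; apply: (@fps_mul_vanish 2 s); first exact: koszul_series_vanish.
exact: fps_deriv_vanish.
Qed.

Lemma koszul_ad_vanish s p : ser_vanish s.+1 p -> ser_vanish s.+2 (koszul_ad p).
Proof.
move=> hp k ks; rewrite /koszul_ad (koszul_field_vanish hp) //.
rewrite (@fps_mul_vanish 1 s.+1) ?subr0 //.
by apply: fps_deriv_vanish; exact: koszul_series_vanish.
Qed.

Lemma field_apply_vanish s t p x : ser_vanish s p -> ser_vanish t.+1 x ->
  ser_vanish (s + t) (field_apply p x).
Proof. by move=> hp hx; apply: fps_mul_vanish => //; exact: fps_deriv_vanish. Qed.

(** The Leibniz rule X(p x') = (X p' - X' p) x' + p (X x')' for vector fields. *)
Lemma koszul_field_apply p x :
  koszul_field K (field_apply p x) =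
  (field_apply (koszul_ad p) x + field_apply p (koszul_field K x) : ser).
Proof.
apply: funext => k; rewrite -[RHS]/(field_apply (koszul_ad p) x k + field_apply p (koszul_field
  K x) k).
(* Two more coefficients are kept than needed, since each of the two nested derivatives loses
   one. *)
pose M := k.+1; pose tr q := \poly_(i < M.+2) q i.
have ag q : agree M.+2 q (tr q) by exact: agree_poly.
have ag1 q : agree M.+1 q (tr q) by exact: agreeS.
have ag0 q : agree M q (tr q) by exact: agreeS.
set X := koszul_series K.
have aX' : agree M.+1 (fps_deriv X) (tr X)^`() by exact: agree_deriv.
have ap' : agree M.+1 (fps_deriv p) (tr p)^`() by exact: agree_deriv.
have ax' : agree M.+1 (fps_deriv x) (tr x)^`() by exact: agree_deriv.
have aYp : agree M.+1 (koszul_field K p) (tr X * (tr p)^`()) by exact: agree_mul.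
have aYx : agree M.+1 (koszul_field K x) (tr X * (tr x)^`()) by exact: agree_mul.
have aW : agree M (koszul_ad p) (tr X * (tr p)^`() - (tr X)^`() * tr p).
  move=> i iM; rewrite /koszul_ad coefB; congr (_ - _).
    exact: (agreeS aYp).
  by apply: (agreeS (agree_mul aX' (ag1 p))).
have aL : agree M (koszul_field K (field_apply p x)) (tr X * (tr p * (tr x)^`())^`()).
  apply: agree_mul => //; apply: agree_deriv; exact: agree_mul.
have aR1 : agree M (field_apply (koszul_ad p) x)
    ((tr X * (tr p)^`() - (tr X)^`() * tr p) * (tr x)^`()).
  by apply: agree_mul => //; exact: agreeS.
have aR2 : agree M (field_apply p (koszul_field K x)) (tr p * (tr X * (tr x)^`())^`()).
  by apply: agree_mul => //; exact: agree_deriv.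
rewrite aL // aR1 // aR2 // -coefD; congr (nth 0 (polyseq _) _).
by rewrite !derivM; ring.
Qed.

Lemma iter_ad_vanish j : ser_vanish j.+1 (iter j koszul_ad fps_t).
Proof. by elim: j => [|j IH]; [case | exact: koszul_ad_vanish]. Qed.
Lemma iter_field_vanish j : ser_vanish j.+1 (iter j (koszul_field K) fps_t).
Proof. by elim: j => [|j IH]; [case | exact: koszul_field_vanish]. Qed.

Lemma field_apply_tt : field_apply fps_t fps_t = fps_t.
Proof.
apply: funext => k; rewrite /field_apply /fps_mul /fps_deriv /fps_t.
case: k => [|k]; first by rewrite big_ord1 mul0r.
rewrite (bigD1 (inord 1)) //= inordK // eqxx mul1r big1 ?addr0 => [|i i1].
  rewrite subn1 /=; case: k => [|k] /=; by rewrite ?mulr1 // mulr0.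
have /negbTE -> : (i : nat) != 1%N by move: i1; rewrite -val_eqE /= inordK.
by rewrite mul0r.
Qed.

(** The coefficient of t^k in exp(ad X) applied to t. *)
Definition exp_ad_coef k : rat := \sum_(j < k.+1) (j`!)%:R^-1 * iter j koszul_ad fps_t k.

Lemma fps_mulZl (c : rat) p q : fps_mul (c *: p) q = (c *: (fps_mul p q : ser)).
Proof.
apply: funext => k; rewrite -[RHS]/(c * fps_mul p q k) mulr_sumr.
by apply: eq_bigr => i _; exact/esym/mulrA.
Qed.
Lemma fps_mulDr p q q' : fps_mul p (q + q') = (fps_mul p q + fps_mul p q' : ser).
Proof.
apply: funext => k; rewrite -[RHS]/(fps_mul p q k + fps_mul p q' k) -big_split.
by apply: eq_bigr => i _; exact: mulrDr.
Qed.
Lemma fps_mulZr (c : rat) p q : fps_mul p (c *: q) = (c *: (fps_mul p q : ser)).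
Proof.
apply: funext => k; rewrite -[RHS]/(c * fps_mul p q k) mulr_sumr.
by apply: eq_bigr => i _; exact: mulrCA.
Qed.
Lemma fps_derivD p q : fps_deriv (p + q) = (fps_deriv p + fps_deriv q : ser).
Proof. by apply: funext => k; exact: mulrDr. Qed.
Lemma fps_derivZ (c : rat) p : fps_deriv (c *: p) = (c *: (fps_deriv p : ser)).
Proof. by apply: funext => k; exact: mulrCA. Qed.

Hypothesis hK : koszul_numbers K.

(** From t = t t' one gets exp(X) t = (exp(ad X) t) (exp(X) t)', and exp(X) t is e^t - 1 with
    derivative e^t. *)
Lemma exp_ad_conv k : \sum_(i < k.+1) exp_ad_coef i / ((k - i)`!)%:R = fps_expm1 k.
Proof.
have lei := @leibniz ser (fun _ => True) field_apply koszul_ad (koszul_field K)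
  (koszul_field K).
pose g i j := field_apply (@dpow ser koszul_ad i fps_t) (@dpow ser (koszul_field K) j fps_t) k.
have dE D j q m : (@dpow ser D j q : ser) m = (j`!)%:R^-1 * iter j D q m by [].
have g0 i j : (k.+1 <= i + j)%N -> g i j = 0.
  move=> h; apply: (@field_apply_vanish i.+1 j); last lia.
    by move=> m mi; rewrite dE iter_ad_vanish ?mulr0.
  by move=> m mi; rewrite dE iter_field_vanish ?mulr0.
have step : exp_koszul_field K fps_t k = \sum_(i < k.+1) \sum_(j < k.+1) g i j.
  rewrite -sum_triangle //; apply: eq_bigr => j _.
  transitivity ((@dpow ser (koszul_field K) j (field_apply fps_t fps_t) : ser) k).
    by rewrite field_apply_tt.
  rewrite lei ?fct_sumE //.
  - by move=> x y _ _; rewrite /koszul_field fps_derivD fps_mulDr.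
  - by move=> *; rewrite /field_apply fps_mulZl.
  - by move=> *; rewrite /field_apply fps_derivZ fps_mulZr.
  - by move=> *; exact: koszul_field_apply.
rewrite -hK step.
(* The reciprocal factorials are read as coefficients of the derivative of e^t - 1. *)
transitivity (\sum_(i < k.+1) exp_ad_coef i * fps_deriv (exp_koszul_field K fps_t) (k - i)%N).
  apply: eq_bigr => i _; rewrite /fps_deriv hK /fps_expm1; congr (_ * _).
  have h := fact_neq0 (k - i)%N.
  rewrite factS natrM invfM mulrA divff ?mul1r //.
  by rewrite Num.Theory.pnatr_eq0.
have adE (i : nat) : (i <= k)%N -> exp_ad_coef i = \sum_(j < k.+1) @dpow ser koszul_ad j fps_t i.
  move=> ik; rewrite /exp_ad_coef -(big_mkord xpredT (fun j =>
    (j`!)%:R^-1 * iter j koszul_ad fps_t i)).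
  rewrite -[RHS](big_mkord xpredT (fun j => (j`!)%:R^-1 * iter j koszul_ad fps_t i)).
  rewrite [RHS](@big_cat_nat _ _ _ i.+1) //= [X in _ + X]big_nat_cond [X in _ + X]big1 ?addr0 //.
  by move=> j /andP[/andP[ij _] _]; rewrite iter_ad_vanish ?mulr0 //; exact: ltnW.
have fE (i : nat) : (i <= k)%N -> fps_deriv (exp_koszul_field K fps_t) i =
    \sum_(j < k.+1) fps_deriv (@dpow ser (koszul_field K) j fps_t) i.
  move=> ik; rewrite /fps_deriv -mulr_sumr; congr (_ * _).
  rewrite /exp_koszul_field -(big_mkord xpredT (fun j =>
    (j`!)%:R^-1 * iter j (koszul_field K) fps_t i.+1)).
  rewrite -[RHS](big_mkord xpredT (fun j => (j`!)%:R^-1 * iter j (koszul_field K) fps_t i.+1)).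
  (* The power j = i + 1 starts in degree i + 2 and contributes nothing in degree i + 1. *)
  rewrite big_nat_recr // iter_field_vanish // mulr0 /= addr0.
  rewrite [RHS](@big_cat_nat _ _ _ i.+1) //= [X in _ + X]big_nat_cond [X in _ + X]big1 ?addr0 //.
  by move=> j /andP[/andP[ij _] _]; rewrite iter_field_vanish ?mulr0.
transitivity (\sum_(m < k.+1) \sum_(i < k.+1) \sum_(j < k.+1)
   @dpow ser koszul_ad i fps_t m * fps_deriv (@dpow ser (koszul_field K) j fps_t) (k - m)%N).
  apply: eq_bigr => m _; rewrite adE ?fE ?leq_subr -1?ltnS //.
  by rewrite mulr_suml; apply: eq_bigr => i _; rewrite mulr_sumr.
rewrite exchange_big /=; apply: eq_bigr => i _; rewrite exchange_big /=.
by apply: eq_bigr => j _.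
Qed.

(* exp(ad X)(t d/dt) = (1 - e^{-t}) d/dt *)
Lemma exp_ad_coefE k : exp_ad_coef k.+1 = (-1) ^+ k / (k.+1`!)%:R.
Proof.
(* The coefficients of 1 - e^(-t), which satisfy the same convolution equation. *)
pose r k : rat := if k is k'.+1 then (-1) ^+ k' / (k`!)%:R else 0.
suff H n : exp_ad_coef n = r n by rewrite H.
have rC m : \sum_(i < m.+1) r i / ((m - i)`!)%:R = fps_expm1 m.
  have E (i : 'I_m.+1) : r i / ((m - i)`!)%:R =
     (i == 0%N :> nat)%:R / (m`!)%:R - (-1) ^+ i / ((i`!)%:R * ((m - i)`!)%:R).
    case: i => [[|i] im] /=; first by rewrite subn0 fact0 expr0 !mul1r mul0r subrr.
    by rewrite mul0r sub0r exprS mulN1r mulNr opprK invfM mulrA.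
  rewrite (eq_bigr _ (fun i _ => E i)) sumrB sum_dpow_inv.
  rewrite big_ord_recl /= big1 ?addr0 => [|i _]; last by rewrite mul0r.
  by case: m {E} => [|m] /=; rewrite ?fact0 ?subr0 ?mul1r // invr1 subrr.
(* The equation is triangular with diagonal entries 1, hence determines its solution degree by
   degree. *)
elim/ltn_ind: n => n IH.
have := exp_ad_conv n; rewrite -rC !big_ord_recr /= subnn fact0 !divr1.
rewrite (eq_bigr (fun i : 'I_n => r i / ((n - i)`!)%:R)); last by move=> i _; rewrite IH.
by move/addrI.
Qed.

End PowerSeries.

(** * The components of the exponential *)

Section Components.
Variable A : superAlgType.
Implicit Types (F G H : cochains A).

Lemma evalcZ n a (f : cochain A n) : evalc (a *: f) = fun l => a *: evalc f l.
Proof. by apply: funext => l; rewrite /evalc; case: ifP => // _; rewrite scaler0. Qed.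

Lemma nr_bracketZr n m (f : cochain A n) (g : cochain A m) a :
  Dn A n f -> Dn A m g -> nr_bracket f (a *: g) = a *: nr_bracket f g.
Proof.
move=> [mf _] [mg _].
have mag : multilinear (a *: g).
  move=> i v k x y; have E w : (a *: g) w = a *: g w by [].
  by rewrite !E mg scalerDr !scalerA mulrC.
rewrite !nr_bracketE // evalcZ; apply: funext => v.
transitivity (a *: cochains_of (lbracket (evalc f) (evalc g)) (n + m) v); last by [].
rewrite /cochains_of scaler_sumr; apply: eq_bigr => par _; rewrite lin0 lbracket_linr;
  last exact: evalc_lmultilin.
by rewrite lbracket_0r ?addr0 //; exact: evalc_lmultilin.
Qed.

Lemma cast_cochainZ n m (e : n = m) a (f : cochain A n) :
  cast_cochain e (a *: f) = a *: cast_cochain e f.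
Proof. by case: _ / e; rewrite !cast_cochain_id. Qed.

Lemma cast_cochain_irr n m (e e' : n = m) (f : cochain A n) :
  cast_cochain e f = cast_cochain e' f.
Proof. by rewrite (eq_irrelevance e e'). Qed.

(** Matching on the reflected comparison provides the proof of n <= k that the cast requires. *)
Lemma bracket_in_degreel n (f : cochain A n) G k : DD A G ->
  bracket (in_degree f) G k =
  if (n <= k)%N =P true is ReflectT nk then cast_cochain (subnKC nk) (nr_bracket f (G (k -
    n)%N)) else 0.
Proof.
move=> hG; case: eqP => nk.
  have nk1 : (n < k.+1)%N by rewrite ltnS.
  rewrite /bracket (bigD1 (Ordinal nk1)) //= in_degree_id.
  rewrite big1 ?addr0 => [|i ni].
    exact: cast_cochain_irr.
  rewrite in_degree_neq; last by rewrite eq_sym.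
  by rewrite nr_bracket0l ?cast_cochain0 //; case: (hG (k - i)%N).
apply: big1 => i _; rewrite in_degree_neq.
  by rewrite nr_bracket0l ?cast_cochain0 //; case: (hG (k - i)%N).
by apply/negP => /eqP e; apply: nk; rewrite e; exact: leq_ord.
Qed.

Lemma bracket_in_degreel_eq n (f : cochain A n) G G' k : DD A G -> DD A G' ->
  ((n <= k)%N -> G (k - n)%N = G' (k - n)%N) ->
  bracket (in_degree f) G k = bracket (in_degree f) G' k.
Proof.
by move=> hG hG' e; rewrite !bracket_in_degreel //; case: eqP => // nk; rewrite e.
Qed.

Lemma bracket_in_degree_neq n m (f : cochain A n) (g : cochain A m) k :
  Dn A n f -> Dn A m g -> (n + m)%N != k -> bracket (in_degree f) (in_degree g) k = 0.
Proof.
move=> hf hg nk; have h0 := @DD_0 A.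
rewrite (@bracket_in_degreel_eq _ _ _ 0) ?bracket0r //; try exact: in_degree_DD.
move=> le; rewrite in_degree_neq //; apply: contra nk => /eqP ->.
by rewrite subnKC.
Qed.

Lemma bracket_in_degree n m (f : cochain A n) (g : cochain A m) :
  Dn A n f -> Dn A m g -> bracket (in_degree f) (in_degree g) = in_degree (nr_bracket f g).
Proof.
move=> hf hg; apply: functional_extensionality_dep => k.
have [<-|nk] := eqVneq (n + m)%N k; last by rewrite bracket_in_degree_neq // in_degree_neq.
have [mf _] := hf; have [mg _] := hg.
rewrite in_degree_id bracketE ?nr_bracketE; try exact: in_degree_DD; try by [].
by rewrite !evalL_in_degree.
Qed.

Lemma component_bracket k F G : DD A F -> DD A G ->
  component k (bracket F G) = \sum_(i < k.+1) bracket (component i F) (component (k - i)%N G).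
Proof.
move=> hF hG; apply: functional_extensionality_dep => j; rewrite /component cochains_sumE.
have [<-|kj] := eqVneq k j; last first.
  rewrite in_degree_neq // big1 // => i _; apply: bracket_in_degree_neq => //.
  by rewrite subnKC // -ltnS.
rewrite in_degree_id [LHS]/bracket; apply: eq_bigr => i _.
rewrite bracket_in_degreel; last exact: in_degree_DD.
have ik : (i <= k)%N by rewrite -ltnS.
case: eqP => [nk|/(_ ik)//]; rewrite in_degree_id.
exact: cast_cochain_irr.
Qed.

(* mu_0 is the identity, so [mu_0, -] acts on D_k by -k. *)
Lemma rho0E G k : DD A G -> rho 0 G k = - k%:R *: G k.
Proof.
move=> hG; have mu0 : @lmu A 0 = @liden A.
  by apply: funext => l; rewrite /lmu (_ : 1`! = 1%N) // invr1 scale1r.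
have hom b L l : lmultilin L -> lsupersym L -> lparity b L ->
  lbracket (@liden A) L l = (1 - (size l)%:R) *: L l.
  move=> mL sL pL; rewrite (lbracket_hom l (@liden_lmultilin A) mL (@liden_lparity A) pL).
  by rewrite lbarwedge_liden_l pL lbarwedge_liden_r // expr0 scale1r scalerBl scale1r.
have E L l : lmultilin L -> lsupersym L -> lbracket (@liden A) L l = (1 - (size l)%:R) *: L l.
  move=> mL sL; rewrite {1}[L]lpartD_fun lbracket_linr; last exact: liden_lmultilin.
  rewrite (hom false (lpart false L)) ?(hom true (lpart true L));
    try (exact: lpart_lmultilin || exact: lpart_lsupersym || exact: lpart_lparity).
  by rewrite scale1r -scalerDr lpartD.
rewrite -(DD_cochains_of (rho_DD 0 hG)) evalL_rho // mu0; apply: funext => v.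
have [mG _] := hG k; transitivity (- k%:R *: cochains_of (evalL G) k v);
  last by rewrite DD_cochains_of.
rewrite /cochains_of scaler_sumr; apply: eq_bigr => par _.
rewrite E; [|exact: DD_lmultilin|exact: DD_lsupersym]; rewrite size_ord_seq -natr1;
  congr (_ *: _).
by rewrite opprD addrCA subrr addr0.
Qed.

Lemma rho_mu n (c : nat -> rat) (F : cochains A) k : (forall m, F m = c m *: mu A m) ->
  (n <= k)%N ->
  rho n F k = (c (k - n)%N * ((n%:R - (k - n)%:R) * (k.+1`!)%:R / ((n.+1`!)%:R *
    ((k - n).+1`!)%:R)))
    *: mu A k.
Proof.
move=> Fc nk; have hF : DD A F.
  move=> m; rewrite Fc; have := @DD_scale A (c m) _ (@mu_DD A m) m.
  have -> : (c m *: in_degree (mu A m) : cochains A) m = c m *: in_degree (mu A m) m by [].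
  by rewrite in_degree_id.
rewrite /rho bracket_in_degreel //; case: eqP => // e.
rewrite Fc nr_bracketZr ?nr_bracket_mu; try exact: mu_Dn.
rewrite 2!cast_cochainZ (cast_cochain_family (mu A)) scalerA !addn1; congr (_ *: _).
by rewrite subnKC.
Qed.

End Components.

(** * From the brackets of the symmetrized products to vector fields, and the recurrence *)

Section Main.
Variables (A : superAlgType) (K : nat -> rat).

(** The factor (k + 1)! is due to [mu A k] corresponding to -t^(k+1)/(k+1)! d/dt; the sign is common
    to all terms and drops out. *)
Definition mu_coef j k : rat := (k.+1`!)%:R * iter j (koszul_ad K) fps_t k.+1.

(** In X p' - X' p the coefficient of t^(n+1) in X meets that of t^(k-n+1) in p with factor (k - n +
    1) - (n + 1), which is the bracket formula up to sign. *)
Lemma koszul_ad_coef (p : nat -> rat) k : p 0%N = 0 ->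
  koszul_ad K p k.+1 =
  - \sum_(1 <= n < k.+1) K n * (n%:R - (k - n)%:R) / (n.+1`!)%:R * p (k - n).+1.
Proof.
move=> p0; rewrite /koszul_ad /koszul_field /fps_mul.
(* The boundary terms vanish because X starts in degree 2 and [p] has no constant term. *)
rewrite big_ord_recl /= {1}/koszul_series /= mul0r add0r.
rewrite big_ord_recl /= {1}/koszul_series /= mul0r add0r.
rewrite [X in _ - X]big_ord_recr /= subnn p0 mulr0 addr0.
rewrite [X in _ - X]big_ord_recl /= {2}/fps_deriv {2}/koszul_series /= mulr0 mul0r add0r.
rewrite -sumrB big_add1 /= big_mkord -sumrN; apply: eq_bigr => i _.
rewrite /koszul_series /fps_deriv /= /bump /= !add1n subSS.
have ik := ltn_ord i; have -> : (k.+1 - i.+1 = (k - i.+1).+1)%N by lia.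
have f1 := fact_neq0 i.+2.
rewrite factS natrM in f1 *.
have [h1 h2] : (i.+2%:R != 0 :> rat) /\ ((i.+1)`!%:R != 0 :> rat).
  by split; [rewrite Num.Theory.pnatr_eq0 | exact: fact_neq0].
rewrite -[i.+2%:R]natr1 in h1 *; rewrite -[(k - i.+1).+1%:R]natr1; field.
by rewrite h2 /= [1 + i%:R]addrC !natr1 Num.Theory.pnatr_eq0.
Qed.

(** The iterates stay in the span of the [mu A k], where the operator acts as ad X on
    coefficients. *)
Lemma iter_koszul_mu j : iter j (koszul_op K) (in_degree (mu A 0)) =
  (fun k => mu_coef j k *: mu A k) :> cochains A.
Proof.
elim: j => [|j IH].
  apply: functional_extensionality_dep => k; rewrite /mu_coef /= /fps_t.
  case: k => [|k]; first by rewrite in_degree_id mulr1 scale1r.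
  by rewrite in_degree_neq // mulr0 scale0r.
rewrite iterS IH; apply: functional_extensionality_dep => k.
rewrite /koszul_op /mu_coef iterS koszul_ad_coef; last exact: iter_ad_vanish.
rewrite mulrN scaleNr mulr_sumr scaler_suml; congr (- _).
rewrite big_nat_cond [RHS]big_nat_cond; apply: eq_bigr => n /andP[/andP[n1 nk] _].
rewrite (@rho_mu _ _ (mu_coef j)) // scalerA; congr (_ *: _).
rewrite /mu_coef.
have h1 := fact_neq0 n.+1; have h2 := fact_neq0 (k - n).+1.
field; by rewrite h1 h2.
Qed.

Lemma exp_mu0 (hK : koszul_numbers K) k :
  exp_koszul_op K (in_degree (mu A 0)) k = (-1) ^+ k *: mu A k.
Proof.
rewrite /exp_koszul_op.
under eq_bigr => j _ do rewrite iter_koszul_mu scalerA.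
rewrite -scaler_suml; congr (_ *: _).
have := exp_ad_coefE hK k; rewrite /exp_ad_coef big_ord_recr /=.
(* The series side has one more power, j = k + 1, which vanishes in degree k + 1. *)
rewrite -[koszul_ad K _ _]/(iter k.+1 (koszul_ad K) fps_t k.+1) iter_ad_vanish // mulr0 addr0
  => E.
have f := fact_neq0 k.+1.
transitivity ((k.+1`!)%:R * ((-1) ^+ k / (k.+1`!)%:R) : rat); last by field.
rewrite -E mulr_sumr; apply: eq_bigr => j _.
by rewrite /mu_coef mulrCA.
Qed.

Lemma cochain0_id : cochain0 (@idfun A) = mu A 0.
Proof.
have [hm _] := @mu_Dn A 0.
apply: funext => v; rewrite [RHS](multilinear_expand v hm).
have e par : mu A 0 (args_comp par v) = hcomp (par ord0) (v ord0).
  rewrite -evalc_tag_seq evalc_mu /tag_seq ord_seqS /ord_seq enum_ord0 /= /lmu (_ : 1`! = 1%N)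
    // invr1 scale1r.
  by rewrite /= tval_mktag.
rewrite (eq_bigr _ (fun par _ => e par)) /cochain0 /=.
rewrite -{1}(hcompD (v ord0)).
rewrite (reindex (fun b : bool => [ffun _ : 'I_1 => b])) /=; last first.
  exists (fun par : {ffun 'I_1 -> bool} => par ord0) => [b _|par _]; first by rewrite ffunE.
  by apply/ffunP => i; rewrite ffunE (ord1 i).
rewrite (eq_bigr (fun b : bool => hcomp b (v ord0))) => [|b _]; last by rewrite ffunE.
by rewrite [RHS]big_bool addrC.
Qed.

Lemma cochain0_Dn (f : {linear A -> A}) : Dn A 0 (cochain0 f).
Proof.
split=> [i v k x y|s par v _].
  by rewrite /cochain0 !ffunE !ord1 eqxx linearP.
rewrite /cochain0 ffunE koszul_sign_prod !big_ord1 ltnn expr0 scale1r.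
by rewrite !ord1.
Qed.

Lemma component_at k (F : cochains A) : component k F k = F k.
Proof. exact: in_degree_id. Qed.

Lemma exp_lowest (f : cochain A 0) : exp_koszul_op K (in_degree f) 0%N = f.
Proof. by rewrite /exp_koszul_op big_ord1 fact0 invr1 scale1r /= in_degree_id. Qed.

(** The exponential of [mu_0, f] = 0 is the bracket of the alternating sum of the mu_h with [H],
    whose component [k] is the recurrence. *)
Lemma exp_recurrence (hK : koszul_numbers K) (f : cochain A 0) k : Dn A 0 f ->
  let H := exp_koszul_op K (in_degree f) in
  k%:R *: H k = \sum_(1 <= h < k.+1) (-1) ^+ h *: rho h H k.
Proof.
move=> hf H; have hF := in_degree_DD hf; have hH : DD A H by exact: exp_DD.
have bz : bracket (in_degree (mu A 0)) (in_degree f) = 0.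
  apply: functional_extensionality_dep => j; rewrite -/(rho 0 (in_degree f)) rho0E //.
  case: j => [|j]; first by rewrite mulr0n oppr0 scale0r.
  by rewrite in_degree_neq // scaler0.
have := exp_bracket K (@mu_DD A 0) hF; rewrite bz -/H.
set Y := exp_koszul_op K (in_degree (mu A 0)) => e.
have e0 : exp_koszul_op K 0 = 0 :> cochains A.
  have := exp_lin K (-1) (@DD_0 A) (@DD_0 A).
  by rewrite !scaleN1r oppr0 addr0 addNr.
have Yk : bracket Y H k = \sum_(0 <= h < k.+1) (-1) ^+ h *: rho h H k.
  (* By locality of the bracket, the image [Y] of mu_0 is replaced by a finite sum. *)
  pose Y' : cochains A := \sum_(0 <= h < k.+1) (-1) ^+ h *: in_degree (mu A h).
  rewrite (@bracket_local _ Y Y' H H) //.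
    rewrite /Y' bracket_suml //; last by move=> h; apply: DD_scale; exact: mu_DD.
    rewrite cochains_sumE; apply: eq_bigr => h _.
    by rewrite bracketZl //; exact: mu_DD.
  move=> i ik; rewrite /Y exp_mu0 // /Y' cochains_sumE (bigD1_seq i) //=; last 2 first.
  - by rewrite mem_index_iota ltnS.
  - exact: (iota_uniq 0 k.+1).
  rewrite -[X in _ = X + _]/((-1) ^+ i *: in_degree (mu A i) i) in_degree_id big1 ?addr0 // =>
    h hi.
  by rewrite -[LHS]/((-1) ^+ h *: in_degree (mu A h) i) in_degree_neq // scaler0.
(* The whole sum is zero, and its term h = 0 is -k times [H k]. *)
move: Yk; rewrite -e e0 big_ltn // expr0 scale1r rho0E // scaleNr => /esym/eqP.
by rewrite addrC subr_eq0 => /eqP ->.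
Qed.

End Main.

Theorem mainTheorem4 (K : nat -> rat) (hK : koszul_numbers K) (A : superAlgType) :
  [/\
      (forall n : nat, Dn A n (mu A n)) /\
      (forall F G : cochains A, DD A F -> DD A G -> DD A (bracket F G)),
      forall n m : nat,
        nr_bracket (mu A n) (mu A m) =
        ((n%:R - m%:R) * ((n + m + 1)`!)%:R
           / (((n + 1)`!)%:R * ((m + 1)`!)%:R)) *: mu A (n + m),
      lie_superalgebra_iso (@exp_koszul_op A K)
    & [/\ forall n : nat,
             Phi K n.+1 (cochain0 (@idfun A)) =
             (-1) ^+ n *: in_degree (mu A n),
          forall (f g : {linear A -> A}) (n : nat), (1 <= n)%N ->
             Phi K n (nr_bracket (cochain0 f) (cochain0 g)) =
             \sum_(1 <= i < n.+1)
               bracket (Phi K i (cochain0 f)) (Phi K (n - i + 1) (cochain0 g)),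
          forall f : {linear A -> A},
             Phi K 1 (cochain0 f) = in_degree (cochain0 f)
        & forall (f : {linear A -> A}) (n : nat), (1 <= n)%N ->
             Phi K n.+1 (cochain0 f) =
             n%:R^-1 *: \sum_(1 <= h < n.+1)
               (-1) ^+ h *: bracket (in_degree (mu A h))
                              (Phi K (n - h + 1) (cochain0 f))]].
Proof.
split.
- by split; [exact: mu_Dn | exact: bracket_DD].
- exact: nr_bracket_mu.
- exact: exp_koszul_iso.
split.
(* The identity of A is mu_0, whose image under the exponential is known. *)
- move=> n; rewrite cochain0_id /Phi /component exp_mu0 //.
  apply: functional_extensionality_dep => k.
  rewrite -[RHS]/((-1) ^+ n *: in_degree (mu A n) k).
  have [<-|nk] := eqVneq n k; first by rewrite !in_degree_id.
  by rewrite !in_degree_neq // scaler0.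
- move=> f g [//|n] _; have hf := cochain0_Dn f; have hg := cochain0_Dn g.
  have e : @in_degree A 0 (nr_bracket (cochain0 f) (cochain0 g)) =
      bracket (in_degree (cochain0 f)) (in_degree (cochain0 g)) by exact: esym
        (bracket_in_degree hf hg).
  rewrite /Phi e.
  rewrite exp_bracket; try exact: in_degree_DD.
  rewrite component_bracket; try (apply: exp_DD; exact: in_degree_DD).
  rewrite big_add1 /= big_mkord; apply: eq_bigr => i _.
  by rewrite addn1 subSS.
- by move=> f; rewrite /Phi /component exp_lowest.
move=> f [//|n] _; have hf := cochain0_Dn f.
set H := exp_koszul_op K (in_degree (cochain0 f)).
have hH : DD A H by apply: exp_DD; exact: in_degree_DD.
have n0 : n.+1%:R != 0 :> rat by rewrite Num.Theory.pnatr_eq0.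
apply: (scalerI n0); rewrite scalerA divff // scale1r.
apply: functional_extensionality_dep => k; rewrite cochains_sumE.
rewrite -[LHS]/(n.+1%:R *: component n.+1 H k).
have [<-|nk] := eqVneq n.+1 k.
  rewrite component_at (exp_recurrence hK n.+1 hf) -/H.
  rewrite big_nat_cond [RHS]big_nat_cond; apply: eq_bigr => h /andP[/andP[h1 hn] _].
  rewrite -[RHS]/((-1) ^+ h *: bracket (in_degree (mu A h)) (Phi K (n.+1 - h + 1) (cochain0 f))
    n.+1).
  (* Component n + 1 of the bracket with mu_h sees only component n + 1 - h of [H]. *)
  congr (_ *: _); apply: bracket_in_degreel_eq => //; first exact: in_degree_DD.
  by move=> _; rewrite /Phi addn1 component_at.
(* Away from index n + 1 both sides vanish, as the degrees h and n + 1 - h add up to n + 1. *)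
rewrite /component in_degree_neq // scaler0 big_nat_cond big1 // => h /andP[/andP[h1 hn] _].
rewrite -[LHS]/((-1) ^+ h *: bracket (in_degree (mu A h)) (Phi K (n.+1 - h + 1) (cochain0 f)) k).
rewrite /Phi /component bracket_in_degree_neq ?scaler0 //; first exact: mu_Dn.
by rewrite addn1 /= subnKC.
Qed.
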